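(* Let $T$ be a complete first-order theory with monster model $\mathfrak{C}$ and $\alpha$ a small ordinal. Suppose that $(H,\cdot)$ is an $\emptyset$-type definable group with $H\subseteq\mathfrak{C}^\alpha$, that $G\leq H$ is a subgroup generated by countably many sets $V_n$, $n<\omega$, each $\emptyset$-type definable, and that $G\leq H_0\leq H$ where $H_0$ is a subgroup which is pseudo $G_\delta$ or pseudo closed (or even pseudo strong Choquet). Assume also that $[H:G]$ is bounded. Then: (1) If $G$ is pseudo $G_\delta$, or pseudo closed, or even pseudo strong Choquet, then $G$ is pseudo closed and in fact is generated by finitely many of the sets $V_n$ in finitely many steps. (2) If $G$ is not pseudo closed then $[H_0:G]\geq2^{\aleph_0}$. (3) If $T$ and $\alpha$ are countable then either $G$ is pseudo closed or the equivalence relation $E_G^{H_0}$ on $H_0$ of being in the same coset modulo $G$ is not smooth. (4) If $T$ is small and $\alpha$ is finite then $G$ is pseudo closed. (5) If the assumption that $[H:G]$ is bounded is removed, then (1) still holds for pseudo closed $G$: if $G$ is pseudo closed then $G$ is generated by finitely many of the sets $V_n$ in finitely many steps.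
   Context: $\mathfrak{C}$ is a monster model of $T$: $\kappa$-saturated and $\kappa$-homogeneous for a big cardinal $\kappa$ (much larger than the size of the language). A set or ordinal is small if of cardinality $<\kappa$; all parameter sets and models ($M\prec\mathfrak{C}$) are small. A cardinal is bounded if it is $<\kappa$. The theory $T$ is small if it has only countably many types over $\emptyset$ (in finitely many variables). $(H,\cdot)$ is an $\emptyset$-type definable group if both $H$ and its multiplication are $\emptyset$-type definable. A subset of $\mathfrak{C}^\alpha$ is pseudo closed if it is type definable over some small set, pseudo open if its complement is pseudo closed, and pseudo $G_\delta$ if it is a countable intersection of pseudo open sets. For a model $M$, $Y_M=\{\operatorname{tp}(a/M)\mid a\in Y\}\subseteq S_\alpha(M)$ with the topology induced from the Stone space; $Y$ is pseudo strong Choquet if $Y_M$ is a strong Choquet space for every model $M$. The strong Choquet game on a topological space $Z$: in round $n<\omega$, player A chooses an open set $O_n\subseteq W_{n-1}$ (where $W_{-1}=Z$) and a point $x_n\in O_n$, and player B responds with an open set $W_n\subseteq O_n$ containing $x_n$; player B wins if $\bigcap_{n<\omega}W_n\neq\emptyset$. $Z$ is strong Choquet if player B has a winning strategy. $G$ is generated by finitely many of the $V_n$ in finitely many steps if there are $N,m<\omega$ such that every element of $G$ is a product of at most $m$ elements of $\bigcup_{n<N}(V_n\cup V_n^{-1})$. $E_G^{H_0}$ is the orbit equivalence relation of $G$ acting on $H_0$ by left multiplication ($h\mathrel{E}h'$ iff $Gh=Gh'$). For a model $M$ and $p,q\in(H_0)_M$, $p\mathrel{(E_G^{H_0})^M}q$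 iff there are $a\models p$, $b\models q$ with $a\mathrel{E_G^{H_0}}b$. In the countable case, ''$E_G^{H_0}$ is smooth'' means that for some (equivalently every) countable model $M$ there is a Borel map $f:(H_0)_M\to2^\omega$ with $p\mathrel{(E_G^{H_0})^M}q\iff f(p)=f(q)$. *)

(* Defs.v *)
From HB Require Import structures.
From mathcomp Require Import all_boot all_classical all_reals all_analysis.

Set Implicit Arguments.
Unset Strict Implicit.
Unset Printing Implicit Defensive.

Local Open Scope classical_set_scope.
Local Open Scope card_scope.

Record language := Language {
  func : Type;
  func_ar : func -> nat;
  rel_sym : Type;
  rel_ar : rel_sym -> nat }.

(* Terms and formulas are well scoped: [V] is the type of free variables, and a
   quantifier binds the variable [None] of its body. *)
Inductive term (L : language) (V : Type) : Type :=
| Var of V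
| App (f : func L) of ('I_(func_ar f) -> term L V).

Inductive formula (L : language) (V : Type) : Type :=
| Bot
| Eq of term L V & term L V
| Rel (r : rel_sym L) of ('I_(rel_ar r) -> term L V)
| Imp of formula L V & formula L V
| All of formula L (option V).

Arguments Bot {L V}.
Arguments Eq {L V}.
Arguments Rel {L V}.
Arguments Imp {L V}.
Arguments All {L V}.

Definition Not (L : language) (V : Type) (phi : formula L V) := Imp phi Bot.
Definition And (L : language) (V : Type) (phi psi : formula L V) :=
  Not (Imp phi (Not psi)).

HB.instance Definition _ (L : language) (V : Type) :=
  gen_eqMixin (formula L V).
HB.instance Definition _ (L : language) (V : Type) :=
  gen_choiceMixin (formula L V).
HB.instance Definition _ (L : language) (V : Type) :=
  isPointed.Build (formula L V) Bot.

Definition sentence (L : language) := formula L void.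

Record structure (L : language) (C : Type) := Structure {
  func_interp : forall f : func L, ('I_(func_ar f) -> C) -> C;
  rel_interp : forall r : rel_sym L, ('I_(rel_ar r) -> C) -> Prop;
  nonempty_universe : inhabited C }.

Fixpoint eval (L : language) (C : Type) (S : structure L C) (V : Type)
    (v : V -> C) (t : term L V) : C :=
  match t with
  | Var x => v x
  | App f ts => func_interp S (fun i => eval S v (ts i))
  end.

Definition extend (V C : Type) (v : V -> C) (c : C) : option V -> C :=
  fun x => if x is Some y then v y else c.

Fixpoint sat (L : language) (C : Type) (S : structure L C) (V : Type)
    (phi : formula L V) : (V -> C) -> Prop :=
  match phi with
  | Bot => fun=> False
  | Eq t u => fun v => eval S v t = eval S v u
  | Rel r ts => fun v => rel_interp S (fun i => eval S v (ts i))
  | Imp phi psi => fun v => sat S phi v -> sat S psi v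
  | All phi => fun v => forall c, sat S phi (extend v c)
  end.

Definition theory (L : language) := set (sentence L).

Definition satisfies (L : language) (C : Type) (S : structure L C)
    (phi : sentence L) : Prop :=
  sat S phi (of_void C).

Definition models (L : language) (C : Type) (S : structure L C)
    (T : theory L) : Prop :=
  forall phi, T phi -> satisfies S phi.

Definition entails (L : language) (T : theory L) (phi : sentence L) : Prop :=
  forall (C : Type) (S : structure L C), models S T -> satisfies S phi.

Definition complete_theory (L : language) (T : theory L) : Prop :=
  (exists (C : Type) (S : structure L C), models S T) /\
  forall phi, entails T phi \/ entails T (Not phi).

Definition countable_language (L : language) : Prop :=
  countable [set: func L] /\ countable [set: rel_sym L].

(* Formulas over [A] in the variables [I] are [formula L (I + A)]. *)
Definition assign (C : Type) (A : set C) (I : Type) (a : I -> C) :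
    (I + A)%type -> C :=
  fun x => match x with inl i => a i | inr c => set_val c end.

Definition holds (L : language) (C : Type) (S : structure L C) (A : set C)
    (I : Type) (phi : formula L (I + A)) (a : I -> C) : Prop :=
  sat S phi (assign a).

Definition finitely_satisfiable (L : language) (C : Type) (S : structure L C)
    (A : set C) (I : Type) (p : set (formula L (I + A))) : Prop :=
  forall F, finite_set F -> F `<=` p ->
    exists a : I -> C, forall phi, F phi -> holds S phi a.

(* [stone S A I] is the space S_I(A) of complete types over [A], a subset of
   the ambient structure, in variables indexed by [I]. *)
Record stone (L : language) (C : Type) (S : structure L C) (A : set C)
    (I : Type) := Stone {
  formulas_of : set (formula L (I + A));
  stone_fsat : finitely_satisfiable S formulas_of;
  stone_complete : forall phi, formulas_of phi \/ formulas_of (Not phi) }.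

Section StoneTopology.
Context (L : language) (C : Type) (S : structure L C) (A : set C) (I : Type).
Implicit Types (p : stone S A I) (phi psi : formula L (I + A)).

Lemma holds_And phi psi (a : I -> C) :
  holds S (And phi psi) a <-> holds S phi a /\ holds S psi a.
Proof.
rewrite /holds /=; split=> [h|[h1 h2] h]; last exact: h.
by split; apply: contrapT => n; apply: h => h1 h2; exact: n.
Qed.

Lemma stone_closed p phi psi chi : formulas_of p phi -> formulas_of p psi ->
  (forall a, holds S phi a -> holds S psi a -> holds S chi a) ->
  formulas_of p chi.
Proof.
move=> pphi ppsi h; have [//|pn] := stone_complete p chi.
have [||a ha] := @stone_fsat _ _ _ _ _ p [set phi; psi; Not chi].
- by rewrite !finite_setU; do !split; exact: finite_set1.
- by move=> _ [[->|->]|->].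
have hn : holds S (Not chi) a by apply: ha; right.
by case: hn; apply: h; apply: ha; left; [left|right].
Qed.

HB.instance Definition _ := gen_eqMixin (stone S A I).
HB.instance Definition _ := gen_choiceMixin (stone S A I).

Definition stone_basic phi : set (stone S A I) :=
  [set p | formulas_of p phi].

Lemma stone_basic_cover : \bigcup_(phi in setT) stone_basic phi = setT.
Proof.
apply/seteqP; split=> // p _.
by have [h|h] := stone_complete p Bot; eexists; [|exact: h| |exact: h].
Qed.

Lemma stone_basic_join phi psi p : [set: formula L (I + A)] phi -> setT psi ->
  stone_basic phi p -> stone_basic psi p ->
  exists chi, [/\ setT chi, stone_basic chi p &
    stone_basic chi `<=` stone_basic phi `&` stone_basic psi].
Proof.
move=> _ _ pphi ppsi; exists (And phi psi); split=> //.
  by apply: (stone_closed pphi ppsi) => a ? ?; apply/holds_And.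
by move=> q qc; split; apply: (stone_closed qc qc) => a /holds_And[].
Qed.

HB.instance Definition _ :=
  isBaseTopological.Build (stone S A I) stone_basic_cover stone_basic_join.

End StoneTopology.

Section TypeOf.
Context (L : language) (C : Type) (S : structure L C) (A : set C) (I : Type).

Lemma tp_fsat (a : I -> C) :
  finitely_satisfiable S [set phi : formula L (I + A) | holds S phi a].
Proof. by move=> F _ FA; exists a => phi /FA. Qed.

Lemma tp_complete (a : I -> C) (phi : formula L (I + A)) :
  holds S phi a \/ holds S (Not phi) a.
Proof. exact: EM. Qed.

Definition tp (a : I -> C) : stone S A I :=
  Stone (@tp_fsat a) (@tp_complete a).

(* For a model [A] this is [Y_A], with its subspace topology when it is
   coerced to a type. *)
Definition types_in (Y : set (I -> C)) : set (stone S A I) := tp @` Y.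

End TypeOf.

Arguments tp {L C} S A {I} a.
Arguments types_in {L C} S A {I} Y.

Definition small_theory (L : language) (C : Type) (S : structure L C) : Prop :=
  forall n : nat, countable [set: stone S set0 'I_n].

Definition card_lt (T U : Type) (A : set T) (B : set U) : Prop :=
  A #<= B /\ ~ (B #<= A).

(* The cardinal kappa is the cardinality of the type [K]. *)
Definition small (K T : Type) (A : set T) : Prop := card_lt A [set: K].

Arguments small K {T} A.

Definition saturated (K : Type) (L : language) (C : Type)
    (S : structure L C) : Prop :=
  forall A : set C, small K A ->
  forall p : stone S A unit, exists c : C, tp S A (fun=> c) = p.

Definition automorphism (L : language) (C : Type) (S : structure L C)
    (s : C -> C) : Prop :=
  [/\ bijective s,
      forall (f : func L) (x : 'I_(func_ar f) -> C),
        s (func_interp S x) = func_interp S (s \o x) &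
      forall (r : rel_sym L) (x : 'I_(rel_ar r) -> C),
        rel_interp S (s \o x) <-> rel_interp S x].

Definition partial_elementary (L : language) (C : Type) (S : structure L C)
    (A : set C) (f : A -> C) : Prop :=
  forall phi : formula L A, sat S phi set_val <-> sat S phi f.

Definition homogeneous (K : Type) (L : language) (C : Type)
    (S : structure L C) : Prop :=
  forall (A : set C) (f : A -> C), small K A -> partial_elementary S f ->
  exists2 s, automorphism S s & forall x : A, s (set_val x) = f x.

(* Of "kappa is much larger than the size of the language" we only ask for
   |L| + aleph_0 < kappa, so that every sufficiently big kappa is covered. *)
Record monster_model (K : Type) (L : language) (T : theory L) (C : Type)
    (S : structure L C) : Prop := MonsterModel {
  monster_models : models S T;
  monster_infinite : small K [set: nat];
  monster_func : small K [set: func L];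
  monster_rel : small K [set: rel_sym L];
  monster_saturated : saturated K S;
  monster_homogeneous : homogeneous K S }.

Definition elementary_substructure (L : language) (C : Type)
    (S : structure L C) (M : set C) : Prop :=
  exists N : structure L M, forall (phi : formula L nat) (v : nat -> M),
    sat N phi v <-> sat S phi (set_val \o v).

Definition small_model (K : Type) (L : language) (C : Type)
    (S : structure L C) (M : set C) : Prop :=
  small K M /\ elementary_substructure S M.

Section Pseudo.
Context (K : Type) (L : language) (C : Type) (S : structure L C) (I : Type).

Definition type_definable (A : set C) (X : set (I -> C)) : Prop :=
  exists pi : set (formula L (I + A)),
    X = [set a | forall phi, pi phi -> holds S phi a].

Definition pseudo_closed (X : set (I -> C)) : Prop :=
  exists2 A : set C, small K A & type_definable A X.

Definition pseudo_open (X : set (I -> C)) : Prop := pseudo_closed (~` X).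

Definition pseudo_Gdelta (X : set (I -> C)) : Prop :=
  exists2 U : nat -> set (I -> C),
    forall n, pseudo_open (U n) & X = \bigcap_n U n.

End Pseudo.

Section StrongChoquet.
Context (Z : topologicalType).

(* A strategy for player B maps the moves (O_0, x_0), ..., (O_n, x_n) made so
   far by player A to the answer W_n. *)
Definition choquet_strategy := seq (set Z * Z) -> set Z.

Definition answer (s : choquet_strategy) (O : nat -> set Z) (x : nat -> Z)
    (n : nat) : set Z :=
  s (mkseq (fun i => (O i, x i)) n.+1).

Definition legal_A (s : choquet_strategy) (O : nat -> set Z) (x : nat -> Z)
    (n : nat) : Prop :=
  [/\ open (O n), O n (x n) &
      O n `<=` (if n is k.+1 then answer s O x k else setT)].

Definition legal_B (s : choquet_strategy) (O : nat -> set Z) (x : nat -> Z)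
    (n : nat) : Prop :=
  [/\ open (answer s O x n), answer s O x n (x n) & answer s O x n `<=` O n].

Definition winning_B (s : choquet_strategy) : Prop :=
  forall O x,
    (forall n, (forall k, (k <= n)%N -> legal_A s O x k) -> legal_B s O x n) /\
    ((forall n, legal_A s O x n) -> \bigcap_n answer s O x n !=set0).

Definition strong_Choquet : Prop := exists s, winning_B s.

End StrongChoquet.

Definition pseudo_strong_Choquet (K : Type) (L : language) (C : Type)
    (S : structure L C) (I : Type) (Y : set (I -> C)) : Prop :=
  forall M : set C, small_model K S M -> strong_Choquet (types_in S M Y).

(* A group with underlying set [H]; the operations are relevant only on [H]. *)
Record group_on (X : Type) (H : set X) := GroupOn {
  mul : X -> X -> X;
  one : X;
  inv : X -> X;
  mul_in : forall x y, H x -> H y -> H (mul x y);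
  one_in : H one;
  inv_in : forall x, H x -> H (inv x);
  mul_assoc : forall x y z, H x -> H y -> H z ->
    mul x (mul y z) = mul (mul x y) z;
  one_mul : forall x, H x -> mul one x = x;
  mul_one : forall x, H x -> mul x one = x;
  inv_mul : forall x, H x -> mul (inv x) x = one;
  mul_inv : forall x, H x -> mul x (inv x) = one }.

Section Groups.
Context (X : Type) (H : set X) (g : group_on H).

Definition subgroup (B : set X) : Prop :=
  [/\ B `<=` H, B (one g),
      forall x y, B x -> B y -> B (mul g x y) &
      forall x, B x -> B (inv g x)].

Definition generated (Y : set X) : set X := smallest subgroup Y.

Definition generated_in_finitely_many_steps (V : nat -> set X) (G : set X) :
    Prop :=
  exists N m : nat, forall x, G x -> exists s : seq X,
    [/\ (size s <= m)%N,
        forall i, (i < size s)%N ->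
          (\bigcup_(n in `I_N) (V n `|` (inv g @` V n))) (nth (one g) s i) &
        x = foldr (mul g) (one g) s].

Definition coset (G : set X) (h : X) : set X := [set mul g x h | x in G].

Definition cosets (G B : set X) : set (set X) := [set coset G h | h in B].

Definition coset_equiv (G B : set X) (h h' : X) : Prop :=
  [/\ B h, B h' & coset G h = coset G h'].

End Groups.

Definition join3 (C I : Type) (a b c : I -> C) : (I + I + I)%type -> C :=
  fun x => match x with
  | inl (inl i) => a i
  | inl (inr i) => b i
  | inr i => c i
  end.

Definition type_definable_group (L : language) (C : Type) (S : structure L C)
    (I : Type) (H : set (I -> C)) (g : group_on H) : Prop :=
  type_definable S set0 H /\
  type_definable S set0
    [set x | exists a b, [/\ H a, H b & x = join3 a b (mul g a b)]].

Definition borel_map (Z W : topologicalType) (f : Z -> W) : Prop :=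
  forall B : set W, <<s [set U : set W | open U] >> B ->
    <<s [set U : set Z | open U] >> (f @^-1` B).

Definition type_equiv (L : language) (C : Type) (S : structure L C)
    (I : Type) (E : (I -> C) -> (I -> C) -> Prop) (M : set C)
    (p q : stone S M I) : Prop :=
  exists a b, [/\ tp S M a = p, tp S M b = q & E a b].

Definition smooth (L : language) (C : Type) (S : structure L C) (I : Type)
    (Y : set (I -> C)) (E : (I -> C) -> (I -> C) -> Prop) : Prop :=
  exists M : set C,
    [/\ countable M, elementary_substructure S M &
        exists2 f : types_in S M Y -> cantor_space, borel_map f &
          forall p q : types_in S M Y,
            type_equiv E (set_val p) (set_val q) <-> f p = f q].

(* Main.v *)
(* [G] is the increasing union of its word balls [W n], which are type-definable
   without parameters.  If no [W n] is all of [G], then some countable subgroup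
   [Gam] of [G] is contained in no [W n].  Let [X] be a minimal nonempty
   [Gam]-invariant closed set over a small set of parameters, taken inside [G] if
   [G] is pseudo closed, and inside [H] otherwise; when [H : G] is bounded, a right
   translation makes it meet [G].  By minimality [G] is dense in [X] and, by
   compactness, the [W n] are nowhere dense in [X].

   The rest is Baire category relative to [X], in the form of Choquet games in
   which player A only plays points of [G].  Played on [G] itself, a winning
   strategy for B yields a point of [G] outside of all the [W n], a contradiction.
   Played on [H0], a Cantor scheme of games yields continuum many cosets; and if
   the coset equivalence were reducible to equality on the Cantor space by a Borel
   map, then that map would be constant on a comeager set by ergodicity of [Gam],
   although each class is meager.  In a small theory with finitely many variables,
   the countably many types over the empty set would be nowhere dense in [X]. *)

Require Import Defs.
From mathcomp Require Import all_boot all_classical all_reals all_analysis.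

Set Implicit Arguments.
Unset Strict Implicit.
Unset Printing Implicit Defensive.

Local Open Scope classical_set_scope.
Local Open Scope card_scope.

(** * Cardinals *)

(** The topology lives on tuples: over a parameter set [A] the type-definable sets are the closed
    sets, and saturation makes them compact as long as [A] and the number of variables are small.
    This explains the constant care for parameters. The countable group [Gam] stands in for [G]
    because a flow needs the coordinates of the acting group as parameters, and those of [G] may be
    too many. Countability matters again for ergodicity, where a union over [Gam] of meager sets has
    to be meager. A Baire argument cannot be run on [G] alone, which is a union of closed sets
    without compactness of its own. The minimal flow [X] supplies a compact space in which the [W n]
    are thin, and the game supplies the completeness of [G] or [H0]. With player A restricted to
    points of [G], the single notion [winnable] covers all three topological hypotheses. The limit
    of a run lies in the set on which the game is played, but perhaps not in [X]; usually this is
    enough, since only membership in the open sets played is wanted. When a limit in [X] is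
    required, countably many formulas defining [X] are imposed during the run. *)

Lemma set_val_inj (T : Type) (A : set T) : injective (@set_val T A).
Proof. by move=> x y; rewrite set_valE; exact: val_inj. Qed.

Definition elt (T : Type) (A : set T) (x : T) (Ax : A x) : A :=
  SigSub (mem_set Ax).

Lemma set_val_in (T : Type) (A : set T) (x : A) : A (set_val x).
Proof. exact: set_valP. Qed.

Definition embeds (T U : Type) : Prop := exists f : T -> U, injective f.

Lemma card_leE (T U : Type) (A : set T) (B : set U) :
  (A #<= B) <-> embeds A B.
Proof.
split=> [/card_leP[f]|[f f_inj]].
  by exists f => x y; apply: (@inj _ _ _ f); rewrite in_setT.
apply/card_leP/injfunPex; exists f => // x y _ _; exact: f_inj.
Qed.

Lemma card_leTE (T U : Type) : ([set: T] #<= [set: U]) <-> embeds T U.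
Proof.
split=> [/card_leE[f f_inj]|[f f_inj]].
  exists (fun x => set_val (f (SigSub (mem_set (I : [set: T] x))))) => x y.
  by move=> /set_val_inj/f_inj[].
apply/card_leE; exists (fun x => SigSub (mem_set (I : [set: U] (f (set_val x))))).
by move=> x y [/f_inj]; apply: set_val_inj.
Qed.

Lemma embeds_trans (T U W : Type) : embeds T U -> embeds U W -> embeds T W.
Proof. by move=> [f f_inj] [h h_inj]; exists (h \o f); exact: inj_comp. Qed.

Lemma embeds_range (T U : Type) (f : T -> U) : embeds (range f) T.
Proof.
have /choice[h hE] (y : range f) : exists x, f x = set_val y.
  by have [x _ e] := set_valP y; exists x.
by exists h => x y e; apply: set_val_inj; rewrite -!hE e.
Qed.

Lemma countable_embeds (T : Type) (A : set T) : countable A -> embeds A nat.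
Proof.
move=> cA; apply/card_leTE; apply: card_le_trans cA.
by have := card_setT A; rewrite card_eq_le => /andP[].
Qed.

Lemma embeds_setU (T : Type) (A B : set T) : embeds (A `|` B) (A + B).
Proof.
apply: (embeds_trans _ (embeds_range (fun x : A + B =>
  match x with inl y => set_val y | inr y => set_val y end))).
apply/card_leE/subset_card_le => x [Ax|Bx]; first by exists (inl (elt Ax)).
by exists (inr (elt Bx)).
Qed.

(** A maximal partial injection, encoded by its graph, is total on one side: otherwise a pair of
    fresh points would extend it. *)
Lemma embeds_total (T U : Type) : embeds T U \/ embeds U T.
Proof.
pose P (R : set (T * U)) := forall r s, R r -> R s -> r.1 = s.1 <-> r.2 = s.2.
have [F FP totF|R [PR Rmax]] := @Zorn_bigcup _ P.
  move=> r s [X FX Xr] [Y FY Ys]; have [XY|YX] := totF _ _ FX FY.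
    by apply: (FP _ FY) => //; exact: XY.
  by apply: (FP _ FX) => //; exact: YX.
have [/choice[f fR]|/existsNP[x /forallNP nx]] :=
    pselect (forall x, exists y, R (x, y)).
  by left; exists f => x y /((PR _ _ (fR x) (fR y)).2).
have [/choice[f fR]|/existsNP[y /forallNP ny]] :=
    pselect (forall y, exists x, R (x, y)).
  by right; exists f => u w /((PR _ _ (fR u) (fR w)).1).
exfalso; apply: (Rmax (R `|` [set (x, y)])).
  split=> [|/(_ (x, y))]; first exact: subsetUl.
  by move=> /(_ (or_intror erefl))/nx.
move=> [a b] [c d] [Rab|[-> ->]] [Rcd|[-> ->]] //=; first exact: PR Rab Rcd.
  by split=> e; subst; [case: (nx b)|case: (ny a)].
by split=> e; subst; [case: (nx d)|case: (ny c)].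
Qed.

Section Square.
Context (U : Type) (e : nat -> U) (e_inj : injective e).

(** [R] is the graph of a pairing on some subset of [U], and the subset is read off the diagonal. *)
Let dom (R : set (U * U * U)) : set U := [set x | exists z, R (x, x, z)].

(** The last clause is conditional because the empty graph, the union of the empty chain, must
    satisfy [P]. *)
Let P (R : set (U * U * U)) :=
  [/\ forall r s, R r -> R s -> r.1 = s.1 <-> r.2 = s.2,
      forall r, R r -> [/\ dom R r.1.1, dom R r.1.2 & dom R r.2],
      forall x y, dom R x -> dom R y -> exists z, R (x, y, z) &
      forall r, R r -> forall n, dom R (e n)].

Let P_chain (F : set (set (U * U * U))) : F `<=` P -> total_on F subset ->
  P (\bigcup_(R in F) R).
Proof.
move=> FP totF.
have dom_sub X : F X -> dom X `<=` dom (\bigcup_(R in F) R).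
  by move=> FX x [z Xz]; exists z, X.
split.
- move=> r s [X FX Xr] [Y FY Ys]; have [XY|YX] := totF _ _ FX FY.
    by have [h _ _ _] := FP _ FY; apply: h => //; exact: XY.
  by have [h _ _ _] := FP _ FX; apply: h => //; exact: YX.
- move=> r [X FX Xr]; have [_ /(_ _ Xr)[? ? ?] _ _] := FP _ FX.
  by split; exact: dom_sub FX _ _.
- move=> x y [z [X FX Xz]] [t [Y FY Yt]]; have [XY|YX] := totF _ _ FX FY.
    have [_ _ h _] := FP _ FY; have [||w Yw] := h x y; last by exists w, Y.
      by exists z; exact: XY.
    by exists t.
  have [_ _ h _] := FP _ FX; have [||w Xw] := h x y; last by exists w, X.
    by exists z.
  by exists t; exact: YX.
- move=> r [X FX Xr] n; have [_ _ _ h] := FP _ FX.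
  by apply: (dom_sub _ FX); exact: h Xr n.
Qed.

Let start : set (U * U * U) :=
  [set r | exists m n, r = (e m, e n, e (pickle (m, n)))].

Let dom_start n : dom start (e n).
Proof. by exists (e (pickle (n, n))); exists n, n. Qed.

Let P_start : P start.
Proof.
split.
- move=> _ _ [m [n ->]] [m' [n' ->]] /=; split=> [[/e_inj-> /e_inj->]//|].
  by move=> /e_inj/(pcan_inj pickleK)[-> ->].
- by move=> _ [m [n ->]]; split; exact: dom_start.
- move=> x y [z [m [n [-> _ _]]]] [t [k [l [-> _ _]]]].
  by exists (e (pickle (m, k))); exists m, k.
- by move=> r _ n; exact: dom_start.
Qed.

(* Zorn's lemma for injections [Y * Y -> Y] with [Y] containing the range of [e]:
   when the complement of a maximal [Y] is at least as big as [Y], a copy [Z] of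
   [Y] in it can host the images of the new pairs of [(Y `|` Z) * (Y `|` Z)]. *)
Lemma embeds_square : embeds (U * U) U.
Proof.
have [R [PR Rmax]] := Zorn_bigcup P_chain.
have [R_inj R_dom R_tot R_e] := PR.
have dom_e n : dom R (e n).
  have [R0|/set0P[r Rr]] := eqVneq R set0; last exact: R_e Rr n.
  exfalso; apply: (Rmax start) => //; rewrite R0; split=> // s0.
  by have [z /s0] := dom_start 0.
pose Y := dom R.
have [f fR] : exists f : U * U -> U, forall x y, Y x -> Y y -> R (x, y, f (x, y)).
  have /choice[f fR] (p : U * U) : exists z, Y p.1 -> Y p.2 -> R (p, z).
    case: p => x y; have [[Yx Yy]|nY] := pselect (Y x /\ Y y).
      by have [z Rz] := R_tot _ _ Yx Yy; exists z.
    by exists x => /= ? ?; case: nY.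
  by exists f => x y Yx Yy; exact: (fR (x, y)).
have f_in x y : Y x -> Y y -> Y (f (x, y)).
  by move=> Yx Yy; have [] := R_dom _ (fR _ _ Yx Yy).
have f_inj x y x' y' : Y x -> Y y -> Y x' -> Y y' ->
    f (x, y) = f (x', y') -> x = x' /\ y = y'.
  move=> Yx Yy Yx' Yy' h.
  by have [] := (R_inj _ _ (fR _ _ Yx Yy) (fR _ _ Yx' Yy')).2 h.
(* If the complement of [Y] embeds into [Y], tagging with [e 0] and [e 1] embeds all of [U] into
   [Y], and the pairing on [Y] then serves for [U]. The other case contradicts maximality. *)
have [[i i_inj]|[i i_inj]] := embeds_total (set_type (~` Y)) (set_type Y).
  have /choice[h hE] (x : U) : exists p : bool * set_type Y,
      (if p.1 then Y x /\ set_val p.2 = x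
       else exists z, set_val z = x /\ p.2 = i z).
    have [Yx|nYx] := pselect (Y x).
      by exists (true, SigSub (mem_set Yx)).
    exists (false, i (SigSub (mem_set (nYx : (~` Y) x)))) => /=.
    by exists (SigSub (mem_set (nYx : (~` Y) x))).
  pose j x := f (e (h x).1, set_val (h x).2).
  have hY x : Y (set_val (h x).2) by exact: set_valP.
  have j_inj : injective j.
    move=> x x' /f_inj[]; try exact: dom_e; try exact: hY.
    move=> /e_inj eb ev; have {}eb : (h x).1 = (h x').1.
      by case: (h x).1 (h x').1 eb => [] [].
    move: (hE x) (hE x'); rewrite eb ev; case: (h x').1 => [[_ <-] []//|].
    move=> [z [ex ez]] [z' [ex' ez']]; rewrite -ex -ex'.
    congr set_val; apply: i_inj.
    by rewrite -ez -ez'; exact: set_val_inj.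
  exists (fun p => f (j p.1, j p.2)) => -[x y] [x' y'] /=.
  have jY z : Y (j z) by apply: (f_in); [exact: dom_e|exact: hY].
  by move=> /f_inj[]; try exact: jY; move=> /j_inj-> /j_inj->.
exfalso.
pose Z := [set set_val (i z) | z in [set: set_type Y]].
have /choice[k kE] (x : U) : exists p : bool * U, (Y `|` Z) x ->
    Y p.2 /\ if p.1 then Y x /\ p.2 = x
             else exists2 z, set_val z = p.2 & set_val (i z) = x.
  have [Yx|nYx] := pselect (Y x); first by exists (true, x).
  have [[z _ ez]|nZ] := pselect (Z x); last by exists (true, x) => -[].
  by exists (false, set_val z) => _; split; [exact: set_valP|exists z].
have k_inj x y : (Y `|` Z) x -> (Y `|` Z) y -> k x = k y -> x = y.
  move=> /kE[_ +] /kE[_ +] exy; rewrite exy.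
  case: (k y).1 => [[_ <-] []//|[z ez <-] [z' ez' <-]].
  by congr (set_val (i _)); apply: set_val_inj; rewrite ez.
have kY x : (Y `|` Z) x -> Y (k x).2 by move=> /kE[].
(* The two tags are binary digits of a number below 4, which keeps the four kinds of pairs apart. *)
pose code x y := f (e ((k x).1 + (k y).1.*2), f ((k x).2, (k y).2)).
have codeY x y : (Y `|` Z) x -> (Y `|` Z) y -> Y (code x y).
  by move=> hx hy; apply: (f_in); [exact: dom_e|apply: (f_in); exact: kY].
have pair_ext (p q : bool * U) : p.1 = q.1 -> p.2 = q.2 -> p = q.
  by case: p q => ? ? [? ?] /= -> ->.
have code_inj x y x' y' : (Y `|` Z) x -> (Y `|` Z) y -> (Y `|` Z) x' ->
    (Y `|` Z) y' -> code x y = code x' y' -> x = x' /\ y = y'.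
  move=> hx hy hx' hy' /f_inj[]; try exact: dom_e;
    try by apply: (f_in); exact: kY.
  move=> /e_inj eb /f_inj[]; do ?exact: kY.
  move=> e1 e2; split; apply: (k_inj) => //; apply: (pair_ext) => //;
    by move: eb; case: (k x).1; case: (k y).1; case: (k x').1; case: (k y').1.
have R_mem r : R r -> [/\ Y r.1.1, Y r.1.2 & r.2 = f r.1].
  case: r => -[x y] z Rr; have [Yx Yy _] := R_dom _ Rr; split=> //=.
  exact: (R_inj _ _ Rr (fR _ _ Yx Yy)).1.
have YZ (z : set_type Y) : ~ Y (set_val (i z)).
  exact: (set_valP (i z)).
pose big := [set r : U * U * U | R r \/
  exists x y, [/\ (Y `|` Z) x, (Y `|` Z) y, ~ (Y x /\ Y y) & exists2 z,
     set_val z = code x y & r = (x, y, set_val (i z))]].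
have dom_big : dom big = Y `|` Z.
  apply/seteqP; split=> x.
    move=> [z [/R_mem[? _ _]|]]; first by left.
    by move=> [a [b [ha _ _ [w _ [-> _ _]]]]].
  have [Yx _|nYx] := pselect (Y x); first by exists (f (x, x)); left; exact: fR.
  move=> hx; exists (set_val (i (SigSub (mem_set (codeY _ _ hx hx))))); right.
  by exists x, x; split=> //; [case|eexists; last reflexivity].
have big_tot x y : (Y `|` Z) x -> (Y `|` Z) y -> exists z, big (x, y, z).
  move=> hx hy; have [[Yx Yy]|nxy] := pselect (Y x /\ Y y).
    by exists (f (x, y)); left; exact: fR.
  exists (set_val (i (SigSub (mem_set (codeY _ _ hx hy))))); right.
  by exists x, y; split=> //; eexists; last reflexivity.
apply: (Rmax big).
  split=> [r Rr|sub]; first by left.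
  have : dom big `<=` Y.
    by move=> x [z /sub xz]; exists z.
  rewrite dom_big => /(_ (set_val (i (SigSub (mem_set (dom_e 0)))))) h.
  by apply: YZ (h _); right; eexists; last reflexivity.
split; rewrite ?dom_big //.
- move=> r s [Rr|[x [y [hx hy nxy [z ez ->]]]]];
    move=> [Rs|[x' [y' [hx' hy' nxy' [z' ez' ->]]]]] /=; first exact: R_inj.
  + have [Yx Yy er] := R_mem _ Rr; split=> [h|h].
      by case: nxy'; rewrite h in Yx Yy.
    by case: (@YZ z'); rewrite -h; have [] := R_dom _ Rr.
  + have [Yx Yy er] := R_mem _ Rs; split=> [h|h].
      by case: nxy; rewrite -h in Yx Yy.
    by case: (@YZ z); rewrite h; have [] := R_dom _ Rs.
  + split=> [[ex ey]|/set_val_inj/i_inj ezz].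
      by congr (set_val (i _)); apply: set_val_inj; rewrite ez ez' ex ey.
    have ec : code x y = code x' y' by rewrite -ez -ez' ezz.
    by have [-> ->] := code_inj _ _ _ _ hx hy hx' hy' ec.
- move=> r [/R_dom[? ? ?]|[x [y [hx hy _ [z _ ->]]]]]; first by split; left.
  by split=> //; right; exists z.
- by move=> r _ n; left; exact: dom_e.
Qed.

End Square.

Definition infinite_type (U : Type) : Prop := embeds nat U.

Lemma embeds_prod (T T' U U' : Type) : embeds T U -> embeds T' U' ->
  embeds (T * T') (U * U').
Proof.
move=> [f f_inj] [h h_inj]; exists (fun p => (f p.1, h p.2)).
by move=> [x y] [x' y'] [/f_inj-> /h_inj->].
Qed.

Lemma embeds_prod_infinite (T T' U : Type) : infinite_type U ->
  embeds T U -> embeds T' U -> embeds (T * T') U.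
Proof.
move=> [e e_inj] TU T'U.
exact: embeds_trans (embeds_prod TU T'U) (embeds_square e_inj).
Qed.

Lemma embeds_sum_infinite (T T' U : Type) : infinite_type U ->
  embeds T U -> embeds T' U -> embeds (T + T') U.
Proof.
move=> U_inf [f f_inj] [h h_inj].
apply: (@embeds_trans _ (nat * U)); last first.
  by apply: embeds_prod_infinite => //; exists id.
exists (fun x => match x with inl y => (0, f y) | inr y => (1, h y) end).
by move=> [x|x] [y|y] // [] => [/f_inj|/h_inj] ->.
Qed.

(** Iterated pairing does not reveal where a sequence stops, so the length is recorded next to
    it. *)
Lemma embeds_seq (U : Type) : infinite_type U -> embeds (seq U) U.
Proof.
move=> U_inf; have [f f_inj] : embeds (U * U) U.
  by apply: embeds_prod_infinite => //; exists id.
apply: (@embeds_trans _ (nat * U)); last first.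
  by apply: embeds_prod_infinite => //; exists id.
have [e _] := U_inf.
exists (fun s => (size s, foldr (fun x y => f (x, y)) (e 0) s)).
elim=> [|x s IH] [|y t] //= [est] /f_inj[-> ets].
by congr (_ :: _); apply: IH; rewrite est ets.
Qed.

Lemma embeds_map_seq (T U : Type) : embeds T U -> embeds (seq T) (seq U).
Proof. by move=> [f f_inj]; exists (map f); exact: inj_map. Qed.

Lemma embeds_tree (T U : Type) : infinite_type U -> embeds T U ->
  embeds (GenTree.tree T) U.
Proof.
move=> U_inf TU; apply: (@embeds_trans _ (seq (nat + T))).
  by exists (@GenTree.encode T); exact: (pcan_inj (GenTree.codeK T)).
apply: embeds_trans (embeds_seq U_inf); apply: embeds_map_seq.
exact: embeds_sum_infinite.
Qed.

(** * Closure properties of small sets *)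

Section Small.
Context (K : Type) (K_inf : small K [set: nat]).

Lemma small_card_le (T U : Type) (A : set T) (B : set U) :
  A #<= B -> small K B -> small K A.
Proof.
move=> AB [BK nKB]; split; first exact: card_le_trans BK.
by move=> KA; apply: nKB; exact: card_le_trans AB.
Qed.

Lemma small_embeds (T U : Type) : embeds T U -> small K [set: U] ->
  small K [set: T].
Proof. by move=> /card_leTE; exact: small_card_le. Qed.

Lemma small_setT (T : Type) (A : set T) : small K A <-> small K [set: A].
Proof.
by split; apply: small_card_le; have := card_setT A; rewrite card_eq_le => /andP[].
Qed.

(** Smallness of sums and products follows by embedding both types into one small infinite [U],
    which absorbs its own square. *)
Lemma small_max (T T' : Type) : small K [set: T] -> small K [set: T'] ->
  exists U, [/\ small K [set: U], infinite_type U, embeds T U & embeds T' U].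
Proof.
wlog TT' : T T' / embeds T T'.
  move=> h sT sT'; have [TT'|TT'] := embeds_total T T'; first exact: h.
  by have [U [? ? ? ?]] := h _ _ TT' sT' sT; exists U.
move=> sT sT'; have [T'n|nT'] := embeds_total T' nat.
  exists nat; split=> //; first by exists id.
  exact: embeds_trans T'n.
by exists T'; split=> //; exists id.
Qed.

Lemma small_prod (T T' : Type) : small K [set: T] -> small K [set: T'] ->
  small K [set: T * T'].
Proof.
move=> sT sT'; have [U [sU U_inf TU T'U]] := small_max sT sT'.
by apply: small_embeds sU; exact: embeds_prod_infinite.
Qed.

Lemma small_sum (T T' : Type) : small K [set: T] -> small K [set: T'] ->
  small K [set: T + T'].
Proof.
move=> sT sT'; have [U [sU U_inf TU T'U]] := small_max sT sT'.
by apply: small_embeds sU; exact: embeds_sum_infinite.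
Qed.

Lemma small_range (T U : Type) (f : T -> U) : small K [set: T] ->
  small K (range f).
Proof. exact/small_card_le/card_image_le. Qed.

Lemma small_setU (T : Type) (A B : set T) : small K A -> small K B ->
  small K (A `|` B).
Proof.
move=> /small_setT sA /small_setT sB; apply/small_setT.
exact: small_embeds (embeds_setU A B) (small_sum sA sB).
Qed.

Lemma small_countable (T : Type) (A : set T) : countable A -> small K A.
Proof. by move=> /small_card_le; exact. Qed.

End Small.

(** * Formulas and saturation *)

Section Formulas.
Context (L : language) (C : Type) (S : structure L C).

Fixpoint trename (V W : Type) (f : V -> W) (t : term L V) : term L W :=
  match t with
  | Var x => Var L (f x)
  | App h ts => App (fun i => trename f (ts i))
  end.

Lemma eval_trename (V W : Type) (f : V -> W) (t : term L V) (v : W -> C) :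
  Defs.eval S v (trename f t) = Defs.eval S (v \o f) t.
Proof. by elim: t => //= h ts IH; congr func_interp; apply/funext. Qed.

Fixpoint frename (V W : Type) (f : V -> W) (phi : formula L V) : formula L W :=
  match phi with
  | Bot => Bot
  | Eq t u => Eq (trename f t) (trename f u)
  | Rel r ts => Rel r (fun i => trename f (ts i))
  | Imp phi psi => Imp (frename f phi) (frename f psi)
  | All phi => All (frename (omap f) phi)
  end.

Lemma extend_omap (V W : Type) (f : V -> W) (v : W -> C) (c : C) :
  extend v c \o omap f = extend (v \o f) c.
Proof. by apply/funext => -[]. Qed.

Lemma sat_frename (V W : Type) (f : V -> W) (phi : formula L V) (v : W -> C) :
  sat S (frename f phi) v <-> sat S phi (v \o f).
Proof.
elim: phi W f v => {V} //= [V t u|V r ts|V phi IH1 psi IH2|V phi IH] W f v.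
- by rewrite !eval_trename.
- by rewrite (_ : (fun i => Defs.eval S v (trename f (ts i))) =
    (fun i => Defs.eval S (v \o f) (ts i))) //; apply/funext => i; rewrite eval_trename.
- by split=> h /IH1/h/IH2.
- split=> h c; last by apply/IH; rewrite extend_omap.
  by have /IH := h c; rewrite extend_omap.
Qed.

Lemma eval_support (V : Type) (t : term L V) : exists F : set V, finite_set F /\
  forall v w : V -> C, (forall x, F x -> v x = w x) ->
    Defs.eval S v t = Defs.eval S w t.
Proof.
elim: t => [x|h ts /choice[F FE]] /=.
  by exists [set x]; split=> [|v w]; [exact: finite_set1|exact].
exists (\bigcup_i F i); split.
  by apply: bigcup_finite => [|i _]; [exact: finite_finset|have [] := FE i].
move=> v w vw; congr func_interp; apply/funext => i; apply: (FE i).2 => x Fx.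
by apply: vw; exists i.
Qed.

Lemma sat_support (V : Type) (phi : formula L V) :
  exists2 F : set V, finite_set F &
    forall v w : V -> C, (forall x, F x -> v x = w x) ->
      sat S phi v -> sat S phi w.
Proof.
elim: phi => {V} /= [V|V t u|V r ts|V phi [F fF FE] psi [G fG GE]|V phi [F fF FE]].
- by exists set0; [exact: finite_set0|].
- have [F [fF FE]] := eval_support t; have [G [fG GE]] := eval_support u.
  exists (F `|` G); first by rewrite finite_setU.
  move=> v w vw; rewrite (FE v w) ?(GE v w) // => x ?; apply: vw; first by right.
  by left.
- have /choice[F FE] := fun i => eval_support (ts i).
  exists (\bigcup_i F i).
    by apply: bigcup_finite => [|i _]; [exact: finite_finset|have [] := FE i].
  move=> v w vw; rewrite (_ : (fun i => Defs.eval S v (ts i)) =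
    (fun i => Defs.eval S w (ts i))) //; apply/funext => i; apply: (FE i).2 => x Fx.
  by apply: vw; exists i.
- exists (F `|` G); first by rewrite finite_setU.
  move=> v w vw h phiw; apply: (GE v w) => [x Gx|]; first by apply: vw; right.
  by apply/h/(FE w v) => // x Fx; rewrite vw //; left.
- exists (some @^-1` F).
    by apply: finite_preimage fF => x y _ _ [].
  by move=> v w vw h c; apply: FE (h c) => -[x|] //=; exact: vw.
Qed.

Definition Ex (V : Type) (phi : formula L (option V)) := Not (All (Not phi)).

Lemma sat_Ex (V : Type) (phi : formula L (option V)) (v : V -> C) :
  sat S (Ex phi) v <-> exists c, sat S phi (extend v c).
Proof.
split=> /= [h|[c h] /(_ c)]; last exact.
by apply: contrapT => /forallNP n; apply: h => c /n.
Qed.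

Definition Conj (V : Type) (s : seq (formula L V)) : formula L V :=
  foldr (@And L V) (Not Bot) s.

Lemma sat_And (V : Type) (phi psi : formula L V) (v : V -> C) :
  sat S (And phi psi) v <-> sat S phi v /\ sat S psi v.
Proof.
split=> [h|[h1 h2] h]; last exact: h h1 h2.
by split; apply: contrapT => n; apply: h => h1 h2; exact: n.
Qed.

Lemma sat_Conj (V : Type) (s : seq (formula L V)) (v : V -> C) :
  sat S (Conj s) v <-> forall phi, phi \in s -> sat S phi v.
Proof.
elim: s => [|psi s IH]; first by split=> [_ phi|_ []].
rewrite /Conj /= -/(Conj s); split.
  by move=> /sat_And[h /IH hs] phi; rewrite inE => /orP[/eqP->|/hs].
move=> h; apply/sat_And; split; first by apply: h; rewrite mem_head.
by apply/IH => phi phis; apply: h; rewrite inE phis orbT.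
Qed.

Lemma project_seq (V : Type) (phi : formula L V) (s : seq {classic V}) :
  exists psi : formula L V, forall v : V -> C, sat S psi v <->
    exists w, (forall x : {classic V}, x \notin s -> w x = v x) /\ sat S phi w.
Proof.
elim: s => [|y s [psi IH]].
  exists phi => v; split=> [h|[w [wv]]]; first by exists v.
  by rewrite (_ : w = v) //; apply/funext => x; exact: wv.
pose f (x : V) : option V := if (x : {classic V}) == y then None else Some x.
exists (Ex (frename f psi)) => v.
have E c : extend v c \o f =
    fun x : V => if (x : {classic V}) == y then c else v x.
  by apply/funext => x /=; rewrite /f; case: eqP.
split=> [/sat_Ex[c /sat_frename]|[w [wv phiw]]].
  rewrite E => /IH[w [wv phiw]]; exists w; split=> // x.
  by rewrite inE negb_or => /andP[/negPf xy xs]; rewrite wv // xy.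
apply/sat_Ex; exists (w y); apply/sat_frename; rewrite E; apply/IH; exists w.
split=> // x xs; case: eqP => [->//|/eqP xy].
by apply: wv; rewrite inE negb_or xy.
Qed.

(** Infinitely many variables may lie outside [D], but only the finitely many in the support of
    [phi] require a quantifier. *)
Lemma project (V : Type) (phi : formula L V) (D : set V) :
  exists psi : formula L V, forall v : V -> C, sat S psi v <->
    exists w, (forall x, D x -> w x = v x) /\ sat S phi w.
Proof.
have [F /(@finite_seqP {classic V})[s Fs] FE] := sat_support phi.
have [psi psiE] := project_seq phi [seq x : {classic V} <- s | `[< ~ D x >]].
exists psi => v; split=> [/psiE|] [w [wv phiw]].
  exists w; split=> // x Dx; apply: wv; rewrite mem_filter.
  by apply/negP => /andP[/asboolP].
apply/psiE; exists (fun x => if `[< F x >] then w x else v x); split.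
  move=> x /negP xn; case: asboolP => // Fx; apply: wv; apply: contrapT => nDx.
  apply: xn; rewrite mem_filter; apply/andP; split; first exact/asboolP.
  by move: Fx; rewrite Fs.
by apply: FE phiw => x Fx; rewrite asboolT.
Qed.

End Formulas.

Arguments sat_frename {L C S V W f phi v}.

(** * Realizing types in many variables from saturation in one variable *)

Section Saturation.
Context (L : language) (C : Type) (S : structure L C).

(** The sets defined by finite parts of [q] generate a proper filter on tuples. An ultrafilter above
    it decides every formula, and finitely many of its members have a common point. *)
Lemma stone_extension (A : set C) (I : Type) (q : set (formula L (I + A))) :
  finitely_satisfiable S q ->
  exists p : stone S A I, q `<=` formulas_of p.
Proof.
move=> q_fs.
pose F : set_system (I -> C) := [set B | exists E, [/\ finite_set E, E `<=` q &
  [set a | forall phi, E phi -> holds S phi a] `<=` B]].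
have F_proper : ProperFilter F.
  apply: Build_ProperFilter_ex.
    by move=> B [E [fE /(q_fs _ fE)[a ha] EB]]; exists a; exact: EB.
  split.
  - by exists set0; split=> //; exact: finite_set0.
  - move=> A1 A2 [E1 [f1 q1 h1]] [E2 [f2 q2 h2]]; exists (E1 `|` E2); split.
    + by rewrite finite_setU.
    + by move=> phi [/q1|/q2].
    + by move=> a ha; split; [apply: h1|apply: h2] => phi ?; apply: ha; [left|right].
  - by move=> A1 A2 A12 [E [fE Eq h]]; exists E; split=> // a /h/A12.
have [U [U_ultra FU]] := ultraFilterLemma F_proper.
pose p := [set phi : formula L (I + A) | U [set a | holds S phi a]].
have p_fs : finitely_satisfiable S p.
  move=> E /finite_seqP[s ->] sp.
  suff /filter_ex[a ha] : U [set a | forall phi, phi \in s -> holds S phi a].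
    by exists a.
  elim: s sp => [|phi s IH] sp; first by apply: filterS filterT.
  apply: filterS (filterI (sp phi (mem_head _ _)) (IH _)).
    by move=> a /= [h hs] psi; rewrite inE => /orP[/eqP->|/hs].
  by move=> psi /= h; apply: sp; rewrite /= inE h orbT.
have p_complete phi : p phi \/ p (Not phi).
  by have [h|h] := in_ultra_setVsetC [set a | holds S phi a] U_ultra; [left|right].
exists (Stone p_fs p_complete) => phi qphi; apply: FU.
by exists [set phi]; split=> [|psi ->|a]; [exact: finite_set1| |exact].
Qed.

Context (K : Type) (S_sat : saturated K S).

(** Projecting the finite conjunctions to [D] and [x0] leaves a type in the single variable [x0]
    over the small set of values of [a] on [D], and [saturated] realizes it. *)
Lemma saturation_step (V : Type) (V_small : small K [set: V])
    (pi : set (formula L V)) (D : set V) (a : V -> C) (x0 : V) :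
  ~ D x0 ->
  (forall F : seq (formula L V), [set` F] `<=` pi ->
    exists b, (forall x, D x -> b x = a x) /\ sat S (Conj F) b) ->
  exists c, forall F : seq (formula L V), [set` F] `<=` pi ->
    exists b, [/\ forall x, D x -> b x = a x, b x0 = c & sat S (Conj F) b].
Proof.
move=> nDx0 fs.
pose A := a @` D.
have sA : small K A.
  by apply: small_card_le V_small; apply: card_le_trans (card_image_le a D) _;
    exact: card_leT.
(* Variables in [D] become parameters and all others the unique variable; after the projection [x0]
   is the only one of the latter that matters. *)
pose rho (x : V) : (unit + A)%type :=
  match pselect (D x) with
  | left Dx => inr (elt (imageP a Dx))
  | right _ => inl tt
  end.
have rhoE c (x : V) : (assign (fun=> c) \o rho) x = if `[< D x >] then a x else c.
  rewrite /rho /=; case: pselect => h /=; first by rewrite asboolT.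
  by rewrite asboolF.
have /choice[psi psiE] F := project S (Conj F) (D `|` [set x0]).
pose q := [set chi | exists2 F : seq (formula L V),
  [set` F] `<=` pi & chi = frename rho (psi F)].
have qE F c : holds S (frename rho (psi F)) (fun=> c) <->
    exists b, [/\ forall x, D x -> b x = a x, b x0 = c & sat S (Conj F) b].
  rewrite /holds; split=> [/sat_frename/psiE[w [wv h]]|[w [wa wx0 h]]].
    exists w; split=> // [x Dx|].
      by rewrite wv; [rewrite rhoE asboolT|left].
    by rewrite wv; [rewrite rhoE asboolF|right].
  apply/sat_frename/psiE; exists w; split=> // x; rewrite rhoE.
  by case: asboolP => [/wa->//|nDx [//|->]].
have q_fs : finitely_satisfiable S q.
  move=> E /finite_seqP[s ->] sq.
  suff [F [Fpi FE]] : exists F : seq (formula L V), [set` F] `<=` pi /\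
      forall c, holds S (frename rho (psi F)) (fun=> c) ->
        forall phi, phi \in s -> holds S phi (fun=> c).
    have [b [ba bF]] := fs _ Fpi; exists (fun=> b x0) => phi /= phis.
    by apply: FE => //; apply/qE; exists b.
  elim: s sq => [|phi s IH] sq; first by exists [::].
  have [|F [Fpi FE]] := IH; first by move=> chi h; apply: sq; rewrite /= inE h orbT.
  have [G Gpi phiE] : q phi by apply: sq; rewrite /= mem_head.
  exists (F ++ G); split=> [chi /=|c /qE[b [ba bx /sat_Conj FGb]] chi].
    by rewrite mem_cat => /orP[/Fpi|/Gpi].
  rewrite inE => /orP[/eqP->|].
    rewrite phiE; apply/qE; exists b; split=> //.
    by apply/sat_Conj => h hG; apply: FGb; rewrite mem_cat hG orbT.
  apply: FE; apply/qE; exists b; split=> //.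
  by apply/sat_Conj => h hG; apply: FGb; rewrite mem_cat hG.
have [p qp] := stone_extension q_fs; have [c cp] := S_sat sA p.
exists c => F Fpi; apply/qE.
have : formulas_of p (frename rho (psi F)) by apply: qp; exists F.
by rewrite -cp.
Qed.

(* The elements of [D] are the parameters, interpreted by [a]; the other
   variables are realized one at a time, along a maximal partial realization. *)
Lemma saturation (V : Type) (V_small : small K [set: V])
    (pi : set (formula L V)) (D : set V) (a : V -> C) :
  (forall F : seq (formula L V), [set` F] `<=` pi ->
    exists b, (forall x, D x -> b x = a x) /\ sat S (Conj F) b) ->
  exists b, (forall x, D x -> b x = a x) /\ forall phi, pi phi -> sat S phi b.
Proof.
move=> fs.
pose P (R : set (V * C)) := forall F : seq (formula L V), [set` F] `<=` pi ->
  exists b, [/\ forall x, D x -> b x = a x, forall x c, R (x, c) -> b x = c &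
    sat S (Conj F) b].
have P_fun R x c c' : P R -> R (x, c) -> R (x, c') -> c = c'.
  by move=> /(_ [::])[//|b [_ bR _]] /bR<- /bR<-.
have [Q QP totQ|R [PR Rmax]] := @Zorn_bigcup _ P.
  have [[R0 QR0]|Q0] := pselect (Q !=set0); last first.
    move=> F Fpi; have [b [ba bF]] := fs F Fpi; exists b; split=> // x c [R QR].
    by case: Q0; exists R.
  have U_fun x c c' : (\bigcup_(R in Q) R) (x, c) -> (\bigcup_(R in Q) R) (x, c') ->
      c = c'.
    move=> [R QR Rx] [R' QR' Rx']; have [RR|RR] := totQ _ _ QR QR'.
      exact: P_fun (QP _ QR') (RR _ Rx) Rx'.
    exact: P_fun (QP _ QR) Rx (RR _ Rx').
  (* The conjunction sees only the finitely many variables in [s], and one member of the chain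
     already contains every value that the union gives to them. *)
  move=> F Fpi; have [E /(@finite_seqP {classic V})[s ->] EF] := sat_support S (Conj F).
  have [R [QR RE]] : exists R, Q R /\ forall x : {classic V}, x \in s -> forall c,
      (\bigcup_(R in Q) R) (x, c) -> R (x, c).
    elim: s {EF} => [|y s [R [QR IH]]]; first by exists R0.
    have [[c [R' QR' Ry]]|ny] :=
        pselect (exists c, (\bigcup_(R in Q) R) (y, c)); last first.
      exists R; split=> // x; rewrite inE => /orP[/eqP->|/IH//] c h.
      by case: ny; exists c.
    have [RR|RR] := totQ _ _ QR QR'.
      exists R'; split=> // x; rewrite inE => /orP[/eqP->|/IH h] c' h'.
        by rewrite -(U_fun y c c') //; exists R'.
      exact/RR/h.
    exists R; split=> // x; rewrite inE => /orP[/eqP->|/IH//] c' h'.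
    by rewrite -(U_fun y c c') //; [exact: RR|exists R'].
  have [b [ba bR bF]] := QP _ QR F Fpi.
  have /choice[b' b'E] x : exists c, (\bigcup_(R in Q) R) (x, c) \/
      (c = b x /\ forall c, ~ (\bigcup_(R in Q) R) (x, c)).
    have [[c h]|/forallNP h] := pselect (exists c, (\bigcup_(R in Q) R) (x, c)).
      by exists c; left.
    by exists (b x); right.
  exists b'; split.
  - move=> x Dx; have [[R' QR' h]|[-> _]] := b'E x; last exact: ba.
    by have [b1 [b1a b1R _]] := QP _ QR' [::] (fun _ h => False_ind _ (notF h));
      rewrite -(b1R _ _ h) b1a.
  - by move=> x c h; have [/U_fun|[_ /(_ c)]] := b'E x; [exact|].
  - apply: EF bF => x /RE h; have [/h/bR//|[->//]] := b'E x.
have R_tot x : exists c, (D x /\ c = a x) \/ R (x, c).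
  have [Dx|nDx] := pselect (D x); first by exists (a x); left.
  apply: contrapT => /forallNP nR.
  have /choice[r rE] y : exists c, (exists c, R (y, c)) -> R (y, c).
    have [[c Rc]|n] := pselect (exists c, R (y, c)); first by exists c.
    by exists (a y).
  pose a' y := if `[< D y >] then a y else r y.
  have [|F Fpi|c cE] := @saturation_step V V_small pi
      (D `|` [set y | exists c, R (y, c)]) a' x.
  - by move=> [//|[c Rc]]; apply: (nR c); right.
  - have [b [ba bR bF]] := PR F Fpi; exists b; split=> // y h.
    rewrite /a'; case: asboolP => [/ba//|nDy]; case: h => // /rE; exact: bR.
  apply: (Rmax (R `|` [set (x, c)])).
    split=> [|/(_ (x, c))]; first exact: subsetUl.
    by move=> /(_ (or_intror erefl)) Rx; apply: (nR c); right.
  move=> F Fpi; have [b [ba bx bF]] := cE F Fpi.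
  have aR y d : R (y, d) -> b y = d.
    move=> Ry; rewrite ba; last by right; exists d.
    have Rr : R (y, r y) by apply: rE; exists d.
    rewrite /a'; case: asboolP => Dy; last exact: P_fun PR Rr Ry.
    by have [b1 [b1a b1R _]] := PR [::] (fun _ h => False_ind _ (notF h));
      rewrite -(b1R _ _ Ry) b1a.
  exists b; split=> // [y Dy|y d [/aR//|[-> ->]]//].
  by rewrite ba; [rewrite /a' asboolT|left].
have /choice[b bE] := R_tot; exists b; split.
  move=> x Dx; have [[]//|Rx] := bE x.
  by have [b1 [b1a b1R _]] := PR [::] (fun _ h => False_ind _ (notF h));
      rewrite -(b1R _ _ Rx) b1a.
move=> phi piphi; have [|b' [b'a b'R /sat_Conj b'F]] := PR [:: phi].
  by move=> psi /=; rewrite inE => /eqP->.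
suff -> : b = b' by apply: b'F; rewrite mem_head.
by apply/funext => x; have [[Dx ->]|/b'R->//] := bE x; rewrite b'a.
Qed.

End Saturation.

(** * Type-definable sets *)

Section TypeDefinable.
Context (L : language) (C : Type) (S : structure L C).

Definition realizations (A : set C) (I : Type) (phi : formula L (I + A)) :
  set (I -> C) := [set a | holds S phi a].

(** These are the preimages under [tp] of the open sets of the Stone space over [A]. *)
Definition type_open (A : set C) (I : Type) (O : set (I -> C)) : Prop :=
  type_definable S A (~` O).

Definition same_type (A : set C) (I : Type) (a b : I -> C) : Prop :=
  forall phi : formula L (I + A), holds S phi a -> holds S phi b.

Section Basic.
Context (A : set C) (I : Type).
Implicit Types (X Y O : set (I -> C)) (a b : I -> C).

Lemma same_type_sym a b : same_type A a b -> same_type A b a.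
Proof.
move=> ab phi phib; apply: contrapT => na; exact: (ab (Not phi) na).
Qed.

Lemma same_type_tp a b : same_type A a b <-> tp S A a = tp S A b.
Proof.
split=> [ab|ab phi phia].
  have E : formulas_of (tp S A a) = formulas_of (tp S A b).
    by apply/seteqP; split=> phi; [exact: ab|exact: (same_type_sym ab)].
  case: (tp S A a) (tp S A b) E => p p1 p2 [q q1 q2] /= E; subst q.
  by congr Stone; exact: Prop_irrelevance.
by have : formulas_of (tp S A a) phi by []; rewrite ab.
Qed.

Lemma type_definable_same_type X a b : type_definable S A X ->
  same_type A a b -> X a -> X b.
Proof. by move=> [pi ->] ab h phi /h/ab. Qed.

Lemma type_open_same_type O a b : type_open A O -> same_type A a b -> O a -> O b.
Proof.
move=> OO /same_type_sym ba Oa; apply: contrapT => nOb.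
by have := type_definable_same_type OO ba nOb.
Qed.

Lemma type_definable_bigcap (J : Type) (P : set J) (F : J -> set (I -> C)) :
  (forall j, P j -> type_definable S A (F j)) ->
  type_definable S A (\bigcap_(j in P) F j).
Proof.
move=> FP; have /choice[pi piE] j : exists pi : set (formula L (I + A)),
    P j -> F j = [set a | forall phi, pi phi -> holds S phi a].
  have [/FP[pi piE]|nPj] := pselect (P j); first by exists pi.
  by exists set0.
exists (\bigcup_(j in P) pi j); apply/seteqP; split=> a.
  by move=> h phi [j Pj]; have := h j Pj; rewrite piE //; exact.
by move=> h j Pj; rewrite piE // => phi piphi; apply: h; exists j.
Qed.

Lemma type_definable_realizations (phi : formula L (I + A)) :
  type_definable S A (realizations phi).
Proof. by exists [set phi]; apply/seteqP; split=> a /= => [h psi ->//|]; exact. Qed.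

Lemma type_definableT : type_definable S A [set: I -> C].
Proof. by exists set0; apply/seteqP; split=> // a _ phi []. Qed.

Lemma type_definable0 : type_definable S A (@set0 (I -> C)).
Proof.
by exists [set Bot]; apply/seteqP; split=> // a h; exact: (h Bot erefl).
Qed.

Lemma type_definableI X Y : type_definable S A X -> type_definable S A Y ->
  type_definable S A (X `&` Y).
Proof.
by rewrite -bigcap2E => tX tY; apply: type_definable_bigcap => -[|[|n]] _ //=;
  exact: type_definableT.
Qed.

Lemma type_definableU X Y : type_definable S A X -> type_definable S A Y ->
  type_definable S A (X `|` Y).
Proof.
move=> [p ->] [q ->]; exists [set chi | exists phi psi,
  [/\ p phi, q psi & chi = Imp (Not phi) psi]].
apply/seteqP; split=> a /=.
  move=> [h|h] _ [phi [psi [pphi qpsi ->]]]; rewrite /holds /= => n.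
    by case: n; exact: h.
  exact: h.
move=> h; apply: contrapT => /not_orP[/existsNP[phi /not_implyP[pphi nphi]]].
move=> /existsNP[psi /not_implyP[qpsi npsi]].
by apply: npsi; apply: (h (Imp (Not phi) psi)) nphi; exists phi, psi.
Qed.

Lemma type_open_realizations (phi : formula L (I + A)) :
  type_open A (realizations phi).
Proof.
rewrite /type_open (_ : ~` _ = realizations (Not phi)) //.
exact: type_definable_realizations.
Qed.

Lemma type_openT : type_open A [set: I -> C].
Proof. by rewrite /type_open setCT; exact: type_definable0. Qed.

Lemma type_open0 : type_open A (@set0 (I -> C)).
Proof. by rewrite /type_open setC0; exact: type_definableT. Qed.

Lemma type_openI X Y : type_open A X -> type_open A Y -> type_open A (X `&` Y).
Proof. by rewrite /type_open setCI; exact: type_definableU. Qed.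

Lemma type_open_bigcup (J : Type) (P : set J) (F : J -> set (I -> C)) :
  (forall j, P j -> type_open A (F j)) -> type_open A (\bigcup_(j in P) F j).
Proof. by rewrite /type_open setC_bigcup; exact: type_definable_bigcap. Qed.

Lemma type_openC X : type_definable S A X -> type_open A (~` X).
Proof. by rewrite /type_open setCK. Qed.

Lemma type_openD O X : type_open A O -> type_definable S A X ->
  type_open A (O `\` X).
Proof. by move=> OO tX; apply: type_openI => //; exact: type_openC. Qed.

Lemma type_definableD X O : type_definable S A X -> type_open A O ->
  type_definable S A (X `\` O).
Proof. exact: type_definableI. Qed.

Lemma type_open_nbhs O a : type_open A O -> O a ->
  exists2 phi : formula L (I + A), holds S phi a & realizations phi `<=` O.
Proof.
move=> [pi /seteqP[E1 E2]] Oa.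
have [phi /not_implyP[piphi nphi]] : exists phi, ~ (pi phi -> holds S phi a).
  by apply/existsNP => /E2.
exists (Not phi) => // b nb; apply: contrapT => /E1/(_ _ piphi); exact: nb.
Qed.

Lemma type_open_forall_in (J : eqType) (s : seq J) (F : J -> set (I -> C)) :
  (forall j, j \in s -> type_open A (F j)) ->
  type_open A [set a | forall j, j \in s -> F j a].
Proof.
elim: s => [|k s IH] h.
  by rewrite (_ : mkset _ = setT); [exact: type_openT|apply/seteqP].
rewrite (_ : mkset _ = F k `&` [set a | forall j, j \in s -> F j a]).
  apply: type_openI; first by apply: h; rewrite mem_head.
  by apply: IH => j js; apply: h; rewrite inE js orbT.
apply/seteqP; split=> a /= => [h'|[Fk Fs] j].
  split; first by apply: h'; rewrite mem_head.
  by move=> j js; apply: h'; rewrite inE js orbT.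
by rewrite inE => /orP[/eqP->|/Fs].
Qed.

Lemma type_definable_point a : (forall i, A (a i)) -> type_definable S A [set a].
Proof.
move=> Aa; exists [set phi | exists i,
  phi = Eq (Var L (inl i)) (Var L (inr (elt (Aa i))))].
apply/seteqP; split=> [b -> _ [i ->]//|b h]; apply/funext => i.
by have := h _ (ex_intro _ i erefl).
Qed.

End Basic.

Lemma type_definable_preimage (A : set C) (I J : Type) (f : I -> J)
    (X : set (I -> C)) : type_definable S A X ->
  type_definable S A [set b : J -> C | X (b \o f)].
Proof.
move=> [pi ->]; pose r (x : I + A) : J + A :=
  match x with inl i => inl (f i) | inr c => inr c end.
have rE (b : J -> C) : assign b \o r = @assign _ A _ (b \o f).
  by apply/funext => -[].
exists (frename r @` pi); apply/seteqP; split=> b /=.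
  by move=> h _ [phi piphi <-]; apply/sat_frename; rewrite rE; exact: h.
move=> h phi piphi; have /sat_frename := h _ (imageP _ piphi).
by rewrite rE.
Qed.

Lemma type_definable_subset (A B : set C) (I : Type) (X : set (I -> C)) :
  A `<=` B -> type_definable S A X -> type_definable S B X.
Proof.
move=> AB [pi ->]; pose r (x : I + A) : I + B :=
  match x with inl i => inl i | inr c => inr (elt (AB _ (set_valP c))) end.
have rE (b : I -> C) : assign b \o r = assign b by apply/funext => -[].
exists (frename r @` pi); apply/seteqP; split=> b /=.
  by move=> h _ [phi piphi <-]; apply/sat_frename; rewrite rE; exact: h.
move=> h phi piphi; have /sat_frename := h _ (imageP _ piphi).
by rewrite rE.
Qed.

Lemma type_open_subset (A B : set C) (I : Type) (X : set (I -> C)) :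
  A `<=` B -> type_open A X -> type_open B X.
Proof. exact: type_definable_subset. Qed.

Section Compactness.
Context (K : Type) (K_inf : small K [set: nat]) (S_sat : saturated K S).

Lemma small_variables (A : set C) (I : Type) : small K A -> small K [set: I] ->
  small K [set: I + A].
Proof. by move=> /small_setT sA sI; exact: small_sum. Qed.

Lemma type_definable_compact (A : set C) (I J : Type) (F : J -> set (I -> C)) :
  small K A -> small K [set: I] -> (forall j, type_definable S A (F j)) ->
  (forall E : set J, finite_set E -> exists a, forall j, E j -> F j a) ->
  exists a, forall j, F j a.
Proof.
move=> sA sI /choice[pi piE] fip.
have [a0 _] := fip set0 (finite_set0 _).
(* The parameters enter as variables whose values are already prescribed by [assign a0]. *)
have [|b [ba bF]] := @saturation _ _ S K S_sat (I + A) (small_variables sA sI)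
    (\bigcup_j pi j) (range inr) (assign a0).
  move=> F' F'pi.
  have [E [E_fin EF]] : exists E, finite_set E /\
      forall phi, phi \in F' -> exists2 j, E j & pi j phi.
    elim: F' F'pi => [|phi s IH] h; first by exists set0; split.
    have [|E [E_fin EF]] := IH.
      by move=> psi hs; apply: h; rewrite /= inE hs orbT.
    have [|j _ pij] := h phi; first by rewrite /= mem_head.
    exists (j |` E); split.
      by rewrite finite_setU; split=> //; exact: finite_set1.
    move=> psi; rewrite inE => /orP[/eqP->|/EF[k Ek]]; first by exists j => //; left.
    by exists k => //; right.
  have [a aE] := fip E E_fin.
  exists (assign a); split=> [_ [c _ <-]//|]; apply/sat_Conj => phi /EF[j Ej].
  by have := aE j Ej; rewrite piE; exact.
exists (b \o inl) => j; rewrite piE => phi piphi.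
have := bF phi (ex_intro2 _ _ j Logic.I piphi); rewrite /holds.
suff -> : assign (b \o inl) = b by [].
by apply/funext => -[//|c]; rewrite ba //; exists c.
Qed.

End Compactness.
End TypeDefinable.

(** * Group identities on the carrier [H] *)

Section GroupLaws.
Context (X : Type) (H : set X) (g : group_on H).
Local Notation "x ** y" := (Defs.mul g x y) (at level 40, left associativity).
Local Notation one := (Defs.one g).
Local Notation inv := (Defs.inv g).

Lemma group_mulKl x y : H x -> H y -> inv x ** (x ** y) = y.
Proof.
move=> Hx Hy; rewrite (mul_assoc g (inv_in g Hx) Hx Hy) inv_mul //.
exact: one_mul.
Qed.

Lemma group_mulVKl x y : H x -> H y -> x ** (inv x ** y) = y.
Proof.
move=> Hx Hy; rewrite (mul_assoc g Hx (inv_in g Hx) Hy) mul_inv //.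
exact: one_mul.
Qed.

Lemma group_mulKr x y : H x -> H y -> x ** y ** inv y = x.
Proof.
move=> Hx Hy; rewrite -(mul_assoc g Hx Hy (inv_in g Hy)) mul_inv //.
exact: mul_one.
Qed.

Lemma group_mulVKr x y : H x -> H y -> x ** inv y ** y = x.
Proof.
move=> Hx Hy; rewrite -(mul_assoc g Hx (inv_in g Hy) Hy) inv_mul //.
exact: mul_one.
Qed.

Lemma group_inv_unique x y : H x -> H y -> x ** y = one -> y = inv x.
Proof.
by move=> Hx Hy e; rewrite -(group_mulKl Hx Hy) e mul_one //; exact: inv_in.
Qed.

Lemma group_invK x : H x -> inv (inv x) = x.
Proof.
move=> Hx; apply/esym/group_inv_unique => //; first exact: inv_in.
exact: inv_mul.
Qed.

Lemma group_invM x y : H x -> H y -> inv (x ** y) = inv y ** inv x.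
Proof.
move=> Hx Hy; have Hix := inv_in g Hx; have Hiy := inv_in g Hy.
apply/esym/group_inv_unique; do ?exact: mul_in.
by rewrite (mul_assoc g (mul_in g Hx Hy) Hiy Hix) group_mulKr // mul_inv.
Qed.

Lemma group_inv1 : inv one = one.
Proof. by apply/esym/group_inv_unique; rewrite ?one_mul //; exact: one_in. Qed.

Lemma idempotent_one x : H x -> x ** x = x -> x = one.
Proof.
move=> Hx xx; have := mul_assoc g (inv_in g Hx) Hx Hx.
by rewrite inv_mul // xx inv_mul // one_mul.
Qed.

End GroupLaws.

(** * Projection and separation of type-definable sets, and group operations on them *)

Section Projection.
Context (L : language) (C : Type) (S : structure L C) (K : Type).
Context (K_inf : small K [set: nat]) (S_sat : saturated K S).

Lemma project_coordinates (A : set C) (I J : Type) (f : I -> J)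
    (phi : formula L (J + A)) : injective f ->
  exists psi : formula L (I + A), forall a,
    holds S psi a <-> exists b, b \o f = a /\ holds S phi b.
Proof.
move=> f_inj.
pose D : set (J + A) := [set x | match x with inl j => range f j | inr _ => True end].
have [psi psiE] := project S phi D.
have /choice[r rE] x : exists y : option (I + A),
    D x -> exists2 z, y = Some z & match z with
      inl i => x = inl (f i) | inr c => x = inr c end.
  case: x => [j|c]; last by exists (Some (inr c)) => _; exists (inr c).
  have [[i _ <-]|n] := pselect (range f j); last by exists None.
  by exists (Some (inl i)) => _; exists (inl i).
(* [psi] depends only on the variables in [D], so that the names given by [r] to the others are
   immaterial; the quantifier removes the spare name [None]. *)
exists (Ex (frename r psi)) => a.
have aE c x (Dx : D x) : forall b, b \o f = a ->
    (extend (assign a) c \o r) x = assign b x.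
  move=> b ba; have [z rx xE] := rE x Dx; rewrite /= rx.
  by case: z xE {rx} => [i|d] -> //=; rewrite -ba.
have glue w c : (forall x, D x -> w x = (extend (assign a) c \o r) x) ->
    w = assign (w \o inl) /\ (w \o inl) \o f = a.
  move=> wE; split.
    apply/funext => -[//|d] /=; rewrite wE //=.
    by have [[i|d'] -> // [->]] := rE (inr d) Logic.I.
  apply/funext => i /=; have h : D (inl (f i)) by exists i.
  by rewrite wE //=; have [[i'|//] -> [/f_inj ->]] := rE _ h.
split=> [/sat_Ex[c /sat_frename/psiE[w [wE h]]]|[b [ba h]]].
  have [w1 w2] := glue _ _ wE; exists (w \o inl); split=> //.
  by rewrite /holds -w1.
have [c] := nonempty_universe S.
apply/sat_Ex; exists c; apply/sat_frename/psiE; exists (assign b); split=> //.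
by move=> x Dx; rewrite (aE c x Dx b ba).
Qed.

(** By saturation, a tuple that extends to a solution of each finite part of [pi] extends to a
    solution of all of [pi]. Hence the projections of the finite conjunctions define the image. *)
Lemma type_definable_image (A : set C) (I J : Type) (f : I -> J)
    (X : set (J -> C)) : small K A -> small K [set: J] -> injective f ->
  type_definable S A X -> type_definable S A [set b \o f | b in X].
Proof.
move=> sA sJ f_inj [pi ->].
exists [set psi | exists2 F : seq (formula L (J + A)), [set` F] `<=` pi &
  forall a, holds S psi a <-> exists b, b \o f = a /\ holds S (Conj F) b].
apply/seteqP; split=> a /=.
  move=> [b bpi <-] psi [F Fpi ->]; exists b; split=> //.
  by apply/sat_Conj => phi /Fpi; exact: bpi.
move=> h.
have ex F : [set` F] `<=` pi -> exists b, b \o f = a /\ holds S (Conj F) b.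
  move=> Fpi; have [psi psiE] := project_coordinates (Conj F) f_inj.
  by apply/psiE/h; exists F.
have [b0 [b0a _]] := ex [::] (fun _ h => False_ind _ (notF h)).
pose D : set (J + A) := [set x | match x with inl j => range f j | inr _ => True end].
have [|w [wD wpi]] := saturation S_sat (small_variables K_inf sA sJ)
    (pi := pi) (D := D) (a := assign b0).
  move=> F /ex[b [ba hb]]; exists (assign b); split=> //.
  move=> [j [i _ <-]|//] /=.
  by have := congr1 (fun g => g i) ba; have /= <- := congr1 (fun g => g i) b0a.
exists (w \o inl).
  move=> phi /wpi; rewrite /holds; suff <- : w = assign (w \o inl) by [].
  by apply/funext => -[//|c]; rewrite wD.
by rewrite -b0a; apply/funext => i /=; rewrite wD //; exists i.
Qed.

(** By compactness a finite part of the definition of [X] is inconsistent with [Y]. The point is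
    that the resulting formula has no parameters from [B]. *)
Lemma type_definable_interpolation (A B : set C) (I : Type)
    (X Y : set (I -> C)) : small K A -> small K B -> small K [set: I] ->
  type_definable S A X -> type_definable S B Y -> X `&` Y = set0 ->
  exists phi : formula L (I + A),
    X `<=` realizations S phi /\ realizations S phi `&` Y = set0.
Proof.
move=> sA sB sI [pi XE] tY XY; apply: contrapT => /forallNP n.
pose F (x : option (formula L (I + A))) : set (I -> C) := match x with
  | Some phi => [set a | pi phi -> holds S phi a] | None => Y end.
have [||||a aF] := @type_definable_compact _ _ S _ K_inf S_sat (A `|` B) I _ F.
- exact: small_setU.
- by [].
- case=> [phi|]; last by apply: type_definable_subset tY => x; right.
  have [piphi|npi] := pselect (pi phi).
    rewrite (_ : F _ = realizations S phi); last first.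
      by apply/seteqP; split=> a /= h //; exact: h.
    apply: type_definable_subset (type_definable_realizations _ _) => x; by left.
  rewrite (_ : F _ = setT); first exact: type_definableT.
  by apply/seteqP; split=> // a _ /npi.
- move=> E /finite_seqP[s Es].
  pose s' := [seq phi <- pmap id s | `[< pi phi >]].
  have := n (Conj s'); rewrite not_andP => -[]; last first.
    move=> /eqP/set0P[a [/sat_Conj as' Ya]]; exists a => -[phi|//].
    rewrite Es /= => phis piphi; apply: as'; rewrite mem_filter.
    apply/andP; split; first exact/asboolP.
    by rewrite mem_pmap; apply/mapP; exists (Some phi).
  case=> a; rewrite XE => aX; apply/sat_Conj => phi; rewrite mem_filter.
  by move=> /andP[/asboolP/aX].
suff : (X `&` Y) a by rewrite XY.
split; last exact: (aF None).
by rewrite XE => phi; exact: (aF (Some phi)).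
Qed.

Definition join2 (I : Type) (a b : I -> C) : I + I -> C :=
  fun x => match x with inl i => a i | inr i => b i end.

(** The types of [a] and [b] over [A] are jointly inconsistent with [R], so by compactness one
    formula from each is too. *)
Lemma type_definable_separation (A : set C) (I : Type) (R : set (I + I -> C))
    (a b : I -> C) : small K A -> small K [set: I] -> type_definable S A R ->
  (forall a' b', same_type S A a a' -> same_type S A b b' -> ~ R (join2 a' b')) ->
  exists phi psi : formula L (I + A), [/\ holds S phi a, holds S psi b &
    forall a' b', holds S phi a' -> holds S psi b' -> ~ R (join2 a' b')].
Proof.
move=> sA sI tR nR; apply: contrapT => nex.
pose G (p : formula L (I + A) * formula L (I + A)) : set (I + I -> C) :=
  [set c : I + I -> C | [/\ holds S p.1 a -> holds S p.1 (c \o inl),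
              holds S p.2 b -> holds S p.2 (c \o inr) & R c]].
have [||||c cG] := @type_definable_compact _ _ S _ K_inf S_sat A (I + I)%type _ G.
- by [].
- exact: small_sum.
- move=> [phi psi].
  rewrite (_ : G _ = [set c : I + I -> C | holds S phi a -> holds S phi (c \o inl)] `&`
    [set c : I + I -> C | holds S psi b -> holds S psi (c \o inr)] `&` R); last first.
    by apply/seteqP; split=> c [] // [].
  apply: type_definableI => //; apply: type_definableI.
    have [h|h] := pselect (holds S phi a); last first.
      rewrite (_ : mkset _ = setT); [exact: type_definableT|].
      by apply/seteqP; split=> // c _ /h.
    rewrite (_ : mkset _ = [set c : I + I -> C | realizations S phi (c \o inl)]).
      exact/type_definable_preimage/type_definable_realizations.
    by apply/seteqP; split=> c /= h' //; exact: h'.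
  have [h|h] := pselect (holds S psi b); last first.
    rewrite (_ : mkset _ = setT); [exact: type_definableT|].
    by apply/seteqP; split=> // c _ /h.
  rewrite (_ : mkset _ = [set c : I + I -> C | realizations S psi (c \o inr)]).
    exact/type_definable_preimage/type_definable_realizations.
  by apply/seteqP; split=> c /= h' //; exact: h'.
- move=> E /finite_seqP[s ->].
  apply: contrapT => /forallNP n; apply: nex.
  exists (Conj [seq p.1 | p <- s & `[< holds S p.1 a >]]).
  exists (Conj [seq p.2 | p <- s & `[< holds S p.2 b >]]).
  split.
  + apply/sat_Conj => phi /mapP[p]; rewrite mem_filter.
    by move=> /andP[/asboolP h _ ->].
  + apply/sat_Conj => phi /mapP[p]; rewrite mem_filter.
    by move=> /andP[/asboolP h _ ->].
  + move=> a' b' /sat_Conj ha /sat_Conj hb Rab; apply: (n (join2 a' b')) => p ps.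
    split=> // h; [apply: ha|apply: hb]; apply/mapP; exists p => //;
      by rewrite mem_filter; apply/andP; split=> //; exact/asboolP.
have : ~ R (join2 (c \o inl) (c \o inr)).
  apply: nR => phi h; first by have [+ _ _] := cG (phi, phi); exact.
  by have [_ + _] := cG (phi, phi); exact.
apply; rewrite (_ : join2 _ _ = c); first by have [] := cG (Bot, Bot).
by apply/funext => -[].
Qed.

Section GroupOperations.
Context (I : Type) (I_small : small K [set: I]) (H : set (I -> C)).
Context (g : group_on H) (H_def : type_definable_group S g).
Implicit Types (A : set C) (X Y : set (I -> C)).

Definition prod_set X Y : set (I -> C) :=
  [set z | exists x y, [/\ X x, Y y & z = Defs.mul g x y]].

Let graph : set (I + I + I -> C) :=
  [set x | exists a b, [/\ H a, H b & x = join3 a b (Defs.mul g a b)]].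

Let graphE c : graph c ->
  [/\ H (c \o (inl \o inl)), H (c \o (inl \o inr)) &
    Defs.mul g (c \o (inl \o inl)) (c \o (inl \o inr)) = c \o inr].
Proof. by move=> [a [b [Ha Hb ->]]]; split. Qed.

Let sub0 A : set0 `<=` A := @sub0set C A.

Let small0 : small K (@set0 C).
Proof. by apply: small_countable => //; exact: countable0. Qed.

Lemma type_definable_H A : type_definable S A H.
Proof. exact: type_definable_subset (@sub0 A) H_def.1. Qed.

Lemma type_definable_prod A X Y : small K A -> X `<=` H -> Y `<=` H ->
  type_definable S A X -> type_definable S A Y ->
  type_definable S A (prod_set X Y).
Proof.
move=> sA XH YH tX tY.
rewrite (_ : prod_set X Y = [set b \o inr | b in
  graph `&`
    ([set b : I + I + I -> C | X (b \o (inl \o inl))] `&`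
    [set b : I + I + I -> C | Y (b \o (inl \o inr))])]).
  apply: type_definable_image => //.
  - by do ?apply: small_sum.
  - by move=> x y [].
  - apply: type_definableI; first exact: type_definable_subset (@sub0 A) H_def.2.
    by apply: type_definableI; exact: type_definable_preimage.
apply/seteqP; split=> z.
  move=> [x [y [Xx Yy ->]]]; exists (join3 x y (Defs.mul g x y)) => //.
  split; last by split.
  by exists x, y; split=> //; [exact: XH|exact: YH].
move=> [b [/graphE[_ _ e] [Xb Yb]] <-].
by exists (b \o (inl \o inl)), (b \o (inl \o inr)).
Qed.

(** The coordinates of the identity need not lie in [A]; it is instead the only idempotent, hence
    cut out by the diagonal of the graph of multiplication. *)
Lemma type_definable_one A : small K A -> type_definable S A [set Defs.one g].
Proof.
move=> sA; rewrite (_ : [set Defs.one g] =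
  [set b : I -> C | graph (b \o (fun x => match x with
     inl (inl i) => i | inl (inr i) => i | inr i => i end))]).
  apply: type_definable_preimage.
  exact: type_definable_subset (@sub0 A) H_def.2.
apply/seteqP; split=> x.
  move=> ->; exists (Defs.one g), (Defs.one g); split; [exact: one_in|exact: one_in|].
  by apply/funext => -[[i|i]|i] //=; rewrite one_mul //; exact: one_in.
by move=> /graphE[Hx _ e]; exact: idempotent_one.
Qed.

Definition inv_set X : set (I -> C) := Defs.inv g @` X.

Lemma inv_set_sub X : X `<=` H -> inv_set X `<=` H.
Proof. by move=> XH _ [x /XH Hx <-]; exact: inv_in. Qed.

Lemma type_definable_inv A X : small K A -> X `<=` H ->
  type_definable S A X -> type_definable S A (inv_set X).
Proof.
move=> sA XH tX.
rewrite (_ : inv_set X = [set b \o (inl \o inr) | b in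
  graph `&`
    ([set b : I + I + I -> C | X (b \o (inl \o inl))] `&`
    [set b : I + I + I -> C | [set Defs.one g] (b \o inr)])]).
  apply: type_definable_image => //.
  - by do ?apply: small_sum.
  - by move=> x y [].
  - apply: type_definableI; last first.
      apply: type_definableI; apply: type_definable_preimage => //.
      exact: type_definable_one.
    exact: type_definable_subset (@sub0 A) H_def.2.
apply/seteqP; split=> z.
  move=> [x Xx <-]; have Hx := XH _ Xx.
  exists (join3 x (Defs.inv g x) (Defs.mul g x (Defs.inv g x))) => //; split.
    by exists x, (Defs.inv g x); split=> //; exact: inv_in.
  by split=> //=; apply/funext => i /=; rewrite mul_inv.
move=> [b [/graphE[Hx Hy e] [Xb /= eb]] <-].
exists (b \o (inl \o inl)) => //; apply/esym/group_inv_unique => //.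
by rewrite e.
Qed.

Lemma type_definable_ratio A X : small K A -> X `<=` H -> type_definable S A X ->
  type_definable S A
    [set c : I + I -> C | [/\ H (c \o inl), H (c \o inr) &
       exists2 w, X w & c \o inl = Defs.mul g w (c \o inr)]].
Proof.
move=> sA XH tX.
pose f (x : I + I) : I + I + I :=
  match x with inl i => inr i | inr i => inl (inr i) end.
rewrite (_ : mkset _ = [set b \o f | b in
  graph `&` [set b : I + I + I -> C | X (b \o (inl \o inl))]]).
  apply: type_definable_image => //.
  - by do ?apply: small_sum.
  - by move=> [x|x] [y|y] // [->].
  - apply: type_definableI; last exact: type_definable_preimage.
    exact: type_definable_subset (@sub0 A) H_def.2.
apply/seteqP; split=> c.
  move=> [Hl Hr [w Xw e]]; exists (join3 w (c \o inr) (Defs.mul g w (c \o inr))).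
    by split=> //; exists w, (c \o inr); split=> //; exact: XH.
  by apply/funext => -[i|i] //=; rewrite -e.
move=> [b [/graphE[Hx Hy e] Xb] <-]; split=> //.
  by rewrite (_ : _ \o inl = b \o inr) // -e; exact: mul_in.
by exists (b \o (inl \o inl)).
Qed.

End GroupOperations.
End Projection.

(** * The downward Lowenheim-Skolem theorem *)

Section CountingFormulas.
Context (L : language) (V0 : Type).

Let letter : Type := func L + rel_sym L + (nat + V0).

(** Arities are finite, so terms and formulas become finite trees over [letter], which are counted
    by [embeds_tree]. *)
Fixpoint term_code (V : Type) (e : V -> nat + V0) (t : term L V) :
    GenTree.tree letter :=
  match t with
  | Var x => GenTree.Leaf (inr (e x))
  | App f ts => GenTree.Node 0 (GenTree.Leaf (inl (inl f) : letter) ::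
      [seq term_code e (ts i) | i <- enum 'I_(func_ar f)])
  end.

(* The letter [inl n] stands for the bound variable of de Bruijn index [n]. *)
Definition bind_code (V : Type) (e : V -> nat + V0) (x : option V) : nat + V0 :=
  match x with
  | None => inl 0
  | Some y => match e y with inl n => inl n.+1 | inr z => inr z end
  end.

Fixpoint formula_code (V : Type) (e : V -> nat + V0) (phi : formula L V) :
    GenTree.tree letter :=
  match phi with
  | Bot => GenTree.Node 0 [::]
  | Eq t u => GenTree.Node 1 [:: term_code e t; term_code e u]
  | Rel r ts => GenTree.Node 2 (GenTree.Leaf (inl (inr r) : letter) ::
      [seq term_code e (ts i) | i <- enum 'I_(rel_ar r)])
  | Imp phi psi => GenTree.Node 3 [:: formula_code e phi; formula_code e psi]
  | All phi => GenTree.Node 4 [:: formula_code (bind_code e) phi]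
  end.

Lemma term_code_inj (V : Type) (e : V -> nat + V0) :
  injective e -> injective (term_code e).
Proof.
move=> e_inj; elim=> [x|f ts IH] [y|h us] //=; first by case=> /e_inj ->.
case=> fh; subst h => /eq_in_map E; congr App; apply/funext => i.
by apply: IH; apply: E; rewrite mem_enum.
Qed.

Lemma bind_code_inj (V : Type) (e : V -> nat + V0) :
  injective e -> injective (bind_code e).
Proof.
move=> e_inj [x|] [y|] //=.
- move=> h; congr Some; apply: e_inj; move: h.
  by case: (e x) (e y) => [m|m] [n|n] // [->].
- by case: (e x).
- by case: (e y).
Qed.

Lemma formula_code_inj (V : Type) (e : V -> nat + V0) :
  injective e -> injective (formula_code e).
Proof.
move=> e_inj phi; elim: phi e e_inj => {V}
    [V|V t u|V r ts|V phi IH1 psi IH2|V phi IH] e e_inj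
    [|t' u'|r' ts'|phi' psi'|phi'] //=.
- by case=> /(term_code_inj e_inj)-> /(term_code_inj e_inj)->.
- case=> rr; subst r' => /eq_in_map E; congr Rel; apply/funext => i.
  by apply: (term_code_inj e_inj); apply: E; rewrite mem_enum.
- by case=> /(IH1 _ e_inj)-> /(IH2 _ e_inj)->.
- by case=> /(IH _ (bind_code_inj e_inj))->.
Qed.

Lemma embeds_formula (U : Type) : infinite_type U -> embeds (func L) U ->
  embeds (rel_sym L) U -> embeds V0 U -> embeds (formula L V0) U.
Proof.
move=> U_inf FU RU VU; apply: (@embeds_trans _ (GenTree.tree letter)).
  by exists (formula_code inr); apply: formula_code_inj => x y [].
by apply: embeds_tree => //; do ?apply: embeds_sum_infinite.
Qed.

End CountingFormulas.

Section LowenheimSkolem.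
Context (L : language) (C : Type) (S : structure L C).

(** The Tarski-Vaught test. Going under a quantifier changes the type of variables, so the induction
    ranges over all variable types that inject into [nat]. Closure under a function symbol is the
    test applied to the equation defining its value. *)
Lemma elementary_of_witnesses (M : set C) : M !=set0 ->
  (forall (phi : formula L (option nat)) (v : nat -> C), (forall n, M (v n)) ->
     (exists c, sat S phi (extend v c)) ->
     exists2 c, M c & sat S phi (extend v c)) ->
  elementary_substructure S M.
Proof.
move=> [m0 Mm0] wit.
have witV V (e : V -> nat) (phi : formula L (option V)) (v : V -> C) :
    injective e -> (forall x, M (v x)) -> (exists c, sat S phi (extend v c)) ->
    exists2 c, M c & sat S phi (extend v c).
  move=> e_inj Mv [c phic].
  have /choice[w wE] n : exists c, M c /\ forall x, e x = n -> c = v x.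
    have [[x <-]|nx] := pselect (exists x, e x = n).
      by exists (v x); split=> // y /e_inj->.
    by exists m0; split=> // x ex; case: nx; exists x.
  have ve : w \o e = v by apply/funext => x; exact: (wE (e x)).2.
  have [n||d Md] := wit (frename (omap e) phi) w.
  - by have [] := wE n.
  - by exists c; apply/sat_frename; rewrite extend_omap ve.
  by move=> /sat_frename; rewrite extend_omap ve => h; exists d.
have Mf (f : func L) (x : 'I_(func_ar f) -> M) :
    M (func_interp S (fun i => set_val (x i))).
  have [||c Mc] := witV _ (@nat_of_ord _)
      (Eq (App (fun i => Var L (Some i))) (Var L None)) (set_val \o x) (@ord_inj _).
  - by move=> i; exact: set_valP.
  - by exists (func_interp S (fun i => set_val (x i))).
  by rewrite /= => ->.
pose N : structure L M := {|
  func_interp := fun f x => elt (Mf f x);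
  rel_interp := fun r x => rel_interp S (fun i => set_val (x i));
  nonempty_universe := inhabits (elt Mm0) |}.
have evalE V (v : V -> M) (t : term L V) :
    set_val (Defs.eval N v t) = Defs.eval S (set_val \o v) t.
  by elim: t => //= f ts IH; congr func_interp; apply/funext => i; exact: IH.
have satE V (phi : formula L V) (e : V -> nat) (v : V -> M) : injective e ->
    sat N phi v <-> sat S phi (set_val \o v).
  elim: phi e v => {V} /= [V|V t u|V r ts|V phi IH1 psi IH2|V phi IH] e v e_inj.
  - by [].
  - by rewrite -!evalE; split=> [->//|]; exact: set_val_inj.
  - suff -> : (fun i => set_val (Defs.eval N v (ts i))) =
      (fun i => Defs.eval S (set_val \o v) (ts i)) by [].
    by apply/funext => i; exact: evalE.
  - by split=> h /(IH1 e v e_inj)/h/(IH2 e v e_inj).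
  - pose e' (x : option V) := if x is Some y then (e y).+1 else 0.
    have e'_inj : injective e' by move=> [x|] [y|] //= [/e_inj->].
    have E c : set_val \o extend v c = extend (set_val \o v) (set_val c).
      by apply/funext => -[].
    split=> h c; last by apply/(IH e' _ e'_inj); rewrite E.
    apply: contrapT => nc.
    have [|||d Md nd] := @witV _ e (Not phi) (set_val \o v) => //.
      by move=> x; exact: set_valP.
      by exists c.
    by apply: nd; have /(IH e' _ e'_inj) := h (elt Md); rewrite E.
by exists N => phi v; exact: (satE _ phi id).
Qed.

(** [M] is a Skolem hull: its points are the values of trees of Skolem functions over [A], so
    counting trees bounds [M]. *)
Lemma downward_Lowenheim_Skolem (A : set C) (U : Type) : infinite_type U ->
  embeds (func L) U -> embeds (rel_sym L) U -> embeds A U ->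
  exists M : set C, [/\ A `<=` M, elementary_substructure S M & embeds M U].
Proof.
move=> U_inf FU RU AU; have [c0] := nonempty_universe S.
have /choice[sk skE] (p : formula L (option nat) * seq C) : exists c,
    (exists d, sat S p.1 (extend (nth c0 p.2) d)) ->
    sat S p.1 (extend (nth c0 p.2) c).
  have [[c h]|n] := pselect (exists d, sat S p.1 (extend (nth c0 p.2) d)).
    by exists c.
  by exists c0.
pose letter : Type := (formula L (option nat) + A)%type.
pose value := fix value (t : GenTree.tree letter) : C :=
  match t with
  | GenTree.Leaf (inl _) => c0
  | GenTree.Leaf (inr a) => set_val a
  | GenTree.Node _ (GenTree.Leaf (inl phi) :: ts) => sk (phi, map value ts)
  | GenTree.Node _ _ => c0
  end.
exists (range value); split.
- by move=> a Aa; exists (GenTree.Leaf (inr (elt Aa))).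
- apply: elementary_of_witnesses; first by exists c0, (GenTree.Node 0 [::]).
  move=> phi v vM [c phic].
  have /choice[t tE] n : exists t, value t = v n.
    by have [t _ <-] := vM n; exists t.
  have [F /(@finite_seqP {classic option nat})[s Fs] FE] := sat_support S phi.
  pose m := \max_(x <- s) (if x is Some n then n else 0).
  (* A Skolem function takes a finite list; the values of [v] up to [m] suffice because [m] bounds
     the variables in the support of [phi]. *)
  pose w := extend (nth c0 (mkseq v m.+1)).
  have wE d x : F x -> extend v d x = w d x.
    rewrite Fs /w; case: x => [n|//] /= ns; rewrite nth_mkseq // ltnS.
    exact: (@leq_bigmax_seq _ s xpredT (fun x => if x is Some n then n else 0) _ ns).
  have phiw : sat S phi (w (sk (phi, mkseq v m.+1))).
    by apply: (skE (phi, mkseq v m.+1)); exists c; apply: FE phic; exact: wE.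
  exists (sk (phi, mkseq v m.+1)).
    exists (GenTree.Node 0 (GenTree.Leaf (inl phi) :: mkseq t m.+1)) => //.
    suff E : map value (mkseq t m.+1) = mkseq v m.+1 by rewrite -E.
    by rewrite /mkseq -map_comp; apply: eq_map => i; exact: tE.
  by apply: FE phiw => x Fx; rewrite wE.
- apply: (@embeds_trans _ (GenTree.tree letter)).
    exact: embeds_range.
  apply: embeds_tree => //; apply: embeds_sum_infinite => //.
  apply: embeds_formula => //; apply: embeds_trans U_inf.
  by exists (fun x => if x is Some n then n.+1 else 0) => -[x|] [y|] // [->].
Qed.

End LowenheimSkolem.

(** * Word balls and minimal flows *)

Section WordBalls.
Context (X : Type) (H : set X) (g : group_on H).
Local Notation "x ** y" := (Defs.mul g x y) (at level 40, left associativity).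
Local Notation one := (Defs.one g).
Local Notation inv := (Defs.inv g).

Fixpoint power (B : set X) (k : nat) : set X :=
  if k is j.+1 then [set x | x = one \/
    exists b y, [/\ B b, power B j y & x = b ** y]]
  else [set one].

Lemma power1 B k : power B k one.
Proof. by case: k => [|k] //=; left. Qed.

Lemma powerS B B' k k' : B `<=` B' -> (k <= k')%N -> power B k `<=` power B' k'.
Proof.
move=> BB; elim: k k' => [|k IH] k'; first by move=> _ x ->; exact: power1.
case: k' => // k' kk x [->|[b [y [/BB Bb /(IH k' kk) py ->]]]]; first exact: power1.
by right; exists b, y.
Qed.

Section Symmetric.
Context (B : set X) (B_sub : B `<=` H).

Lemma power_sub k : power B k `<=` H.
Proof.
elim: k => [|k IH] x /=; first by move=> ->; exact: one_in.
move=> [->|[b [y [/B_sub Hb /IH Hy ->]]]]; [exact: one_in|exact: mul_in].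
Qed.

Lemma power_mul j k x y : power B j x -> power B k y -> power B (j + k) (x ** y).
Proof.
move=> + yk; have Hy := power_sub yk.
elim: j x => [|j IH] x; first by move=> ->; rewrite one_mul.
move=> [->|[b [z [Bb zj ->]]]].
  rewrite one_mul //; apply: (@powerS B B k) yk => //; exact: (leq_addl j.+1).
right; exists b, (z ** y); split=> //; first exact: IH.
by rewrite (mul_assoc g (B_sub Bb) (power_sub zj) Hy).
Qed.

Lemma power_inv k x : inv @` B `<=` B -> power B k x -> power B k (inv x).
Proof.
move=> B_inv; elim: k x => [|k IH] x; first by move=> ->; exact: group_inv1.
move=> [->|[b [z [Bb zk ->]]]]; first by left; exact: group_inv1.
rewrite (group_invM g (B_sub Bb) (power_sub zk)) -addn1.
apply: power_mul; first exact: IH.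
right; exists (inv b), one; split=> //; first by apply: B_inv; exists b.
by rewrite mul_one //; exact: (inv_in g (B_sub Bb)).
Qed.

Lemma power_seq k x : power B k x -> exists s : seq X,
  [/\ (size s <= k)%N, forall i, (i < size s)%N -> B (nth one s i) &
      x = foldr (Defs.mul g) one s].
Proof.
elim: k x => [|k IH] x /=; first by move=> ->; exists [::].
move=> [->|[b [z [Bb /IH[s [sk sB ->]] ->]]]]; first by exists [::].
by exists (b :: s); split=> // -[|i] //=; exact: sB.
Qed.

End Symmetric.

Lemma power_subgroup_sub B k (G : set X) : subgroup g G -> B `<=` G ->
  power B k `<=` G.
Proof.
move=> [GH G1 GM GV] BG; elim: k => [|k IH] x /=; first by move=> ->.
by move=> [->//|[b [y [/BG Gb /IH Gy ->]]]]; exact: GM.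
Qed.

Lemma countable_power B k : countable B -> countable (power B k).
Proof.
move=> cB; elim: k => [|k IH] /=; first exact: countable1.
apply: (@sub_countable _ _ _ ([set one] `|`
    (fun p => p.1 ** p.2) @` (B `*` power B k))).
  apply: subset_card_le => x [->|[b [y [Bb py ->]]]]; first by left.
  by right; exists (b, y).
rewrite -bigcup2E; apply: bigcup_countable => [|[|[|n]] _] /=.
- exact: countableP.
- exact: countable1.
- apply: sub_countable (card_image_le _ _) _; exact: countableX.
- exact: countable0.
Qed.

Definition symmetrization (B : set X) : set X := B `|` inv @` B.

Lemma symmetrization_sub B : B `<=` H -> symmetrization B `<=` H.
Proof. by move=> BH x [/BH//|[y /BH Hy <-]]; exact: inv_in. Qed.

Lemma symmetrization_inv B : B `<=` H ->
  inv @` symmetrization B `<=` symmetrization B.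
Proof.
move=> BH _ [x [Bx|[y By <-]] <-]; first by right; exists x.
by left; rewrite group_invK //; exact: BH.
Qed.

Lemma subgroup_bigcup_power B : B `<=` H ->
  subgroup g (\bigcup_k power (symmetrization B) k).
Proof.
move=> BH; have sH := symmetrization_sub BH; split.
- by move=> x [k _ /(power_sub sH)].
- by exists 0.
- move=> x y [j _ xj] [k _ yk]; exists (j + k) => //; exact: power_mul.
- by move=> x [k _ xk]; exists k => //; apply: power_inv => //;
    exact: symmetrization_inv.
Qed.

Section Balls.
Context (V : nat -> set X) (V_sub : forall n, V n `<=` H).

Definition letters (n : nat) : set X :=
  \bigcup_(k in `I_n) (V k `|` (inv @` V k)).

(** One index bounds both the alphabet and the length, so being contained in a single ball is
    generation by finitely many sets in finitely many steps. *)
Definition word_ball (n : nat) : set X := power (letters n) n.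

Lemma letters_sub n : letters n `<=` H.
Proof. by move=> x [k _ /symmetrization_sub]; apply; exact: V_sub. Qed.

Lemma letters_inv n : inv @` letters n `<=` letters n.
Proof.
by move=> _ [x [k kn xk] <-]; exists k => //; apply: symmetrization_inv => //;
  exists x.
Qed.

Lemma lettersS m n : (m <= n)%N -> letters m `<=` letters n.
Proof. by move=> mn x [k km xk]; exists k => //; exact: leq_trans mn. Qed.

Lemma word_ballS m n : (m <= n)%N -> word_ball m `<=` word_ball n.
Proof. by move=> mn; apply: powerS => //; exact: lettersS. Qed.

Lemma word_ball_sub n : word_ball n `<=` H.
Proof. exact/power_sub/letters_sub. Qed.

Lemma word_ball_mul m n x y : word_ball m x -> word_ball n y ->
  word_ball (m + n) (x ** y).
Proof.
move=> xm yn; apply: power_mul; first exact: letters_sub.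
  by apply: (@powerS _ _ m) xm => //; apply: lettersS; exact: leq_addr.
by apply: (@powerS _ _ n) yn => //; apply: lettersS; exact: leq_addl.
Qed.

Lemma word_ball_inv n x : word_ball n x -> word_ball n (inv x).
Proof. by apply: power_inv; [exact: letters_sub|exact: letters_inv]. Qed.

Lemma subgroup_generated (Y : set X) : Y `<=` H -> subgroup g (generated g Y).
Proof.
move=> YH; split.
- move=> x; apply; split=> //; split=> //; first exact: one_in.
    by move=> *; exact: mul_in.
  by move=> *; exact: inv_in.
- by move=> M [[]].
- by move=> x y Gx Gy M sM; have [[_ _ h _] _] := sM; apply: h; [exact: Gx|exact: Gy].
- by move=> x Gx M sM; have [[_ _ _ h] _] := sM; apply: h; exact: Gx.
Qed.

Lemma generated_word_ball : generated g (\bigcup_n V n) = \bigcup_n word_ball n.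
Proof.
have VH : \bigcup_n V n `<=` H by move=> x [n _ /V_sub].
have [GH G1 GM GV] := subgroup_generated VH.
apply/seteqP; split=> x.
  apply; split.
    split.
    - by move=> y [n _ /word_ball_sub].
    - by exists 0 => //; exact: power1.
    - by move=> y z [m _ ym] [n _ zn]; exists (m + n) => //; exact: word_ball_mul.
    - by move=> y [n _ yn]; exists n => //; exact: word_ball_inv.
  move=> y [n _ Vy]; exists n.+1 => //; right; exists y, one; split.
  - by exists n => //=; left.
  - exact: power1.
  - by rewrite mul_one //; exact: V_sub Vy.
move=> [n _]; apply: power_subgroup_sub; first exact: subgroup_generated.
have VG k : V k `<=` generated g (\bigcup_n V n).
  by move=> y Vy M [_]; apply; exists k.
by move=> y [k _ [/VG//|[z /VG Gz <-]]]; exact: GV.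
Qed.

End Balls.
End WordBalls.

Definition coordinates (I C : Type) (X : set (I -> C)) : set C :=
  [set c | exists2 x, X x & exists i, x i = c].

Lemma embeds_coordinates (I C : Type) (X : set (I -> C)) :
  embeds (coordinates X) (X * I).
Proof.
apply: (embeds_trans _ (embeds_range (fun p : X * I => set_val p.1 p.2))).
apply/card_leE/subset_card_le => c [x Xx [i <-]].
by exists (elt Xx, i).
Qed.

Section Flows.
Context (L : language) (C : Type) (S : structure L C) (K : Type).
Context (K_inf : small K [set: nat]) (S_sat : saturated K S).
Context (I : Type) (I_small : small K [set: I]) (H : set (I -> C)).
Context (g : group_on H) (H_def : type_definable_group S g).
Local Notation "x ** y" := (Defs.mul g x y) (at level 40, left associativity).
Local Notation one := (Defs.one g).
Local Notation inv := (Defs.inv g).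

Lemma small_coordinates (X : set (I -> C)) : small K X -> small K (coordinates X).
Proof.
move=> /small_setT sX; apply/small_setT.
by apply: small_embeds (embeds_coordinates X) _; exact: small_prod.
Qed.

Definition invariant_under (Gam X : set (I -> C)) : Prop :=
  forall c x, Gam c -> X x -> X (c ** x).

(** Every [Gam]-orbit of a point of [X] is dense in [X] for the topology over [A]. *)
Definition transitive_under (A : set C) (Gam X : set (I -> C)) : Prop :=
  forall O x, type_open S A O -> O `&` X !=set0 -> X x ->
    exists2 c, Gam c & O (c ** x).

Section Translations.
Context (A : set C) (A_small : small K A) (Gam : set (I -> C)).
Context (Gam_sub : subgroup g Gam) (Gam_A : coordinates Gam `<=` A).

Let GamH : Gam `<=` H. Proof. by have [] := Gam_sub. Qed.

Lemma type_definable_translate c Z : Gam c -> type_definable S A Z ->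
  type_definable S A [set x | H x /\ Z (c ** x)].
Proof.
move=> Gc tZ; have Hc := GamH Gc.
have cH : [set c] `<=` H by move=> x ->.
rewrite (_ : mkset _ = prod_set g (inv_set g [set c]) (H `&` Z)).
  apply: (type_definable_prod K_inf S_sat) => //.
  - exact: inv_set_sub.
  - by apply: (type_definable_inv K_inf S_sat) => //; apply: type_definable_point;
      move=> i; apply: Gam_A; exists c => //; exists i.
  - by apply: type_definableI => //; exact: (type_definable_H H_def).
apply/seteqP; split=> x.
  move=> [Hx Zx]; exists (inv c), (c ** x); split.
  - by exists c.
  - by split=> //; exact: mul_in.
  - by rewrite group_mulKl.
move=> [_ [y [[_ -> <-] [Hy Zy] ->]]].
by split; [apply: mul_in => //; exact: inv_in|rewrite group_mulVKl].
Qed.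

Lemma type_definable_avoid O : type_open S A O ->
  type_definable S A [set x | H x /\ forall c, Gam c -> ~ O (c ** x)].
Proof.
move=> OO; rewrite (_ : mkset _ = H `&`
    \bigcap_(c in Gam) [set x | H x /\ (~` O) (c ** x)]).
  apply: type_definableI; first exact: (type_definable_H H_def).
  by apply: type_definable_bigcap => c Gc; exact: type_definable_translate.
apply/seteqP; split=> x [Hx h]; split=> //.
  by move=> c Gc; split=> //; exact: h.
by move=> c /h[].
Qed.

Definition is_flow (X : set (I -> C)) : Prop :=
  [/\ type_definable S A X, X !=set0 & invariant_under Gam X].

(** Zorn's lemma is applied to the parts removed from [P], so that unions of chains correspond to
    intersections of flows; compactness keeps these nonempty. *)
Lemma minimal_flow P : P `<=` H -> is_flow P ->
  exists X, [/\ X `<=` P, is_flow X &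
    forall Y, Y `<=` X -> is_flow Y -> X `<=` Y].
Proof.
move=> PH [tP P0 iP].
have [F FP totF|Z [flZ Zmax]] := @Zorn_bigcup _ [set Z | is_flow (P `\` Z)].
  pose D (Z : set (I -> C)) := if `[< F Z >] then P `\` Z else P.
  have [p Pp] := P0.
  have [a aD] : exists a, forall o, (if o is Some Z then D Z else P) a.
    apply: (type_definable_compact K_inf S_sat) => //.
    - exact: A_small.
    - case=> [Z|//]; rewrite /D; case: asboolP => // /FP[]//.
    - move=> E /finite_seqP[s ->].
      have [Z [FZ sZ]] : exists Z, is_flow (P `\` Z) /\
          forall Z', Some Z' \in s -> F Z' -> Z' `<=` Z.
        suff [Z [h sZ]] : exists Z, (F Z \/ Z = set0) /\
          forall Z', Some Z' \in s -> F Z' -> Z' `<=` Z.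
          exists Z; split=> //; case: h => [/FP//|->]; rewrite setD0; split=> //.
        elim: s => [|[Z'|] s [Z [h IH]]].
        - by exists set0; split=> //; right.
        - have [FZ'|nF] := pselect (F Z'); last first.
            exists Z; split=> // Y; rewrite inE => /orP[/eqP[->] /nF//|].
            exact: IH.
          have [ZZ|ZZ] : Z `<=` Z' \/ Z' `<=` Z.
            by case: h => [/totF/(_ FZ')//|->]; left.
          + exists Z'; split; first by left.
            move=> Y; rewrite inE => /orP[/eqP[-> _]|Ys FY]; first exact: subset_refl.
            exact: subset_trans (IH Y Ys FY) ZZ.
          + exists Z; split=> // Y; rewrite inE => /orP[/eqP[->] _//|].
            exact: IH.
        - by exists Z; split=> // Y; rewrite inE => /orP[/eqP//|]; exact: IH.
      have [_ [a [Pa nZa]] _] := FZ; exists a => -[Z'|//] /= Z's.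
      rewrite /D; case: asboolP => // FZ'; split=> // Za.
      exact/nZa/(sZ _ Z's FZ').
  have Pa : P a := aD None.
  have E : P `\` \bigcup_(Z in F) Z = P `&` \bigcap_(Z in F) (P `\` Z).
    apply/seteqP; split=> x [Px h]; split=> //.
      by move=> Z FZ; split=> // Zx; apply: h; exists Z.
    by move=> [Z FZ Zx]; have [] := h Z FZ.
  split; rewrite E.
  - by apply: type_definableI => //; apply: type_definable_bigcap => Z /FP[].
  - exists a; split=> // Z FZ.
    by have := aD (Some Z); rewrite /= /D asboolT.
  - move=> c x Gc [Px h]; split; first exact: iP.
    by move=> Z FZ; have [_ _ iZ] := FP _ FZ; apply: iZ => //; exact: h.
exists (P `\` Z); split=> // Y YX [tY Y0 iY] x [Px nZx].
apply: contrapT => nYx; apply: (Zmax (~` Y)).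
  split; first by move=> z Zz /YX[_].
  by move=> /(_ x nYx).
rewrite /= (_ : P `\` ~` Y = Y) //.
apply/seteqP; split=> z; first by move=> [_ /contrapT].
by move=> Yz; split; [have [] := YX _ Yz|move=> /(_ Yz)].
Qed.

(** If the orbit of [x] avoided [O], the points of [X] with this property would form a flow, hence
    be all of [X], against the point of [X] in [O]. *)
Lemma minimal_flow_transitive X : X `<=` H -> is_flow X ->
  (forall Y, Y `<=` X -> is_flow Y -> X `<=` Y) -> transitive_under A Gam X.
Proof.
move=> XH [tX X0 iX] Xmin O x OO [y [Oy Xy]] Xx; apply: contrapT => nO.
have [_ G1 GM _] := Gam_sub.
pose Y := X `&` [set x | H x /\ forall c, Gam c -> ~ O (c ** x)].
have : X `<=` Y.
  apply: Xmin => [z []//|]; split.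
  - apply: type_definableI => //; exact: type_definable_avoid.
  - exists x; split=> //; split; first exact: XH.
    by move=> c Gc Oc; apply: nO; exists c.
  - move=> c z Gc [Xz [Hz nz]]; split; first exact: iX.
    split; first by apply: mul_in => //; exact: GamH.
    move=> d Gd; rewrite mul_assoc; [|exact: GamH|exact: GamH|by []].
    by apply: nz; exact: GM.
move=> /(_ y Xy)[_ [Hy /(_ _ G1)]]; rewrite one_mul //.
Qed.

End Translations.

(** The closure of [X] in the topology over [A]. *)
Definition hull (A : set C) (X : set (I -> C)) : set (I -> C) :=
  [set a | forall phi : formula L (I + A),
     X `<=` realizations S phi -> holds S phi a].

Lemma type_definable_hull A X : type_definable S A (hull A X).
Proof. by exists [set phi | X `<=` realizations S phi]. Qed.

Lemma hull_sup A X : X `<=` hull A X.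
Proof. by move=> x Xx phi; exact. Qed.

Lemma hull_min A X Y : type_definable S A Y -> X `<=` Y -> hull A X `<=` Y.
Proof.
by move=> [pi ->] XY x hx phi piphi; apply: hx => y /XY; exact.
Qed.

(** [X] is compact, so its image among the types over [A] is already closed and taking the hull adds
    no new type. *)
Lemma hull_same_type A A' X x : small K A -> small K A' ->
  type_definable S A' X -> hull A X x -> exists2 y, X y & same_type S A x y.
Proof.
move=> sA sA' tX hx.
pose F (o : option (formula L (I + A))) : set (I -> C) :=
  if o is Some phi then [set y | holds S phi x -> holds S phi y] else X.
have [|||y yF] := type_definable_compact K_inf S_sat (A := A `|` A') (F := F) _ I_small.
- exact: small_setU.
- case=> [phi|] /=; last by apply: type_definable_subset tX => z; right.
  have [h|h] := pselect (holds S phi x).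
    rewrite (_ : mkset _ = realizations S phi).
      by apply: type_definable_subset (type_definable_realizations _ _) => z; left.
    by apply/seteqP; split=> y //= h'; exact: h'.
  rewrite (_ : mkset _ = setT); first exact: type_definableT.
  by apply/seteqP; split=> // y _ /h.
- move=> E /finite_seqP[s ->].
  pose s' := [seq phi <- pmap id s | `[< holds S phi x >]].
  apply: contrapT => /forallNP n.
  have : holds S (Not (Conj s')) x.
    apply: hx => y Xy /sat_Conj h; apply: (n y) => -[phi|//] /= phis hphi.
    apply: h; rewrite mem_filter; apply/andP; split; first exact/asboolP.
    by rewrite mem_pmap; apply/mapP; exists (Some phi).
  apply; apply/sat_Conj => phi; rewrite mem_filter.
  by move=> /andP[/asboolP].
by exists y; [exact: (yF None)|move=> phi; exact: (yF (Some phi))].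
Qed.

(* A minimal flow in [H] meets some right coset of [G]; once a representative of
   that coset is a parameter, the flow can be translated into one meeting [G].
   Taking the hull over [B] afterwards removes the extra parameters. *)
Lemma flow_in_bounded_index (G Gam : set (I -> C)) (B : set C) : small K B ->
  subgroup g G -> small K (cosets g G H) -> subgroup g Gam -> Gam `<=` G ->
  coordinates Gam `<=` B ->
  exists X, [/\ X `<=` H, type_definable S B X, invariant_under Gam X,
     X `&` G !=set0 & transitive_under B Gam X].
Proof.
move=> sB [GH G1 GM GV] idx sGam GamG GamB.
have /choice[r rE] (c : cosets g G H) : exists h, H h /\ Defs.coset g G h = set_val c.
  by have [h Hh e] := set_valP c; exists h.
pose B' := B `|` coordinates (range r).
have sB' : small K B'.
  apply: small_setU => //; apply: small_coordinates; apply: small_range.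
  by move: idx => /small_setT.
have BB' : B `<=` B' by move=> x; left.
have GamB' : coordinates Gam `<=` B' by move=> x /GamB; left.
have [GamH Gam1 GamM GamV] := sGam.
have [X0 [X0H fX0 X0min]] : exists X, [/\ X `<=` H, is_flow B' Gam X &
    forall Y, Y `<=` X -> is_flow B' Gam Y -> X `<=` Y].
  apply: minimal_flow => //; split; first exact: (type_definable_H H_def).
    by exists one; exact: one_in.
  by move=> c x /GamH Hc Hx; exact: mul_in.
have [tX0 [x0 X0x0] iX0] := fX0.
have X0trans := minimal_flow_transitive sB' sGam GamB' X0H fX0 X0min.
have Hx0 := X0H _ X0x0.
have cx0 : cosets g G H (Defs.coset g G x0) by exists x0.
pose h := r (elt cx0); have [Hh eh] := rE (elt cx0); rewrite -/h in Hh eh.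
have [a Ga ea] : Defs.coset g G h x0.
  by rewrite eh; exists one => //; exact: one_mul.
have Hih := inv_in g Hh.
have hH : [set h] `<=` H by move=> x ->.
have th : type_definable S B' [set h].
  apply: type_definable_point => i; right; exists h; last by exists i.
  by exists (elt cx0).
(* Right translation commutes with the left action of [Gam], and it carries [x0] to [a], a point of
   [G]. *)
pose X1 := prod_set g X0 (inv_set g [set h]).
have tX1 : type_definable S B' X1.
  apply: (type_definable_prod K_inf S_sat) => //; first exact: inv_set_sub.
  exact: (type_definable_inv K_inf S_sat).
have X1E z : X1 z <-> exists2 x, X0 x & z = x ** inv h.
  split=> [[x [_ [Xx [_ -> <-] ->]]]|[x Xx ->]]; first by exists x.
  by exists x, (inv h); split=> //; exists h.
have X1H : X1 `<=` H by move=> z /X1E[x /X0H Hx ->]; exact: mul_in.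
have iX1 : invariant_under Gam X1.
  move=> c z Gc /X1E[x Xx ->]; apply/X1E; exists (c ** x); first exact: iX0.
  by rewrite mul_assoc //; [exact: GamH|exact: X0H].
have X1trans : transitive_under B' Gam X1.
  move=> O z OO [w [Ow /X1E[y Xy wE]]] /X1E[x Xx ->].
  pose N := prod_set g (H `\` O) [set h].
  have tN : type_open S B' (~` N).
    apply: type_openC; apply: (type_definable_prod K_inf S_sat) => //.
    by apply: type_definableD => //; exact: (type_definable_H H_def).
  have [|c Gc nN] := X0trans _ x tN _ Xx.
    exists y; split=> // -[u [_ [[Hu nOu] -> yE]]]; apply: nOu.
    by rewrite -(group_mulKr g Hu Hh) -yE -wE.
  have Hc := GamH _ Gc; have Hx := X0H _ Xx; have Hcx := mul_in g Hc Hx.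
  exists c => //; apply: contrapT => nO; apply: nN.
  exists (c ** x ** inv h), h; split=> //; last by rewrite group_mulVKr.
  by split; [exact: mul_in|rewrite -mul_assoc].
exists (hull B X1); split.
- by apply: hull_min => //; exact: (type_definable_H H_def).
- exact: type_definable_hull.
- move=> c x Gc hx.
  suff : hull B X1 `<=` [set x | H x /\ hull B X1 (c ** x)] by move=> /(_ x hx)[].
  apply: hull_min.
    apply: (type_definable_translate sB sGam GamB Gc); exact: type_definable_hull.
  by move=> y Xy; split; [exact: X1H|apply: hull_sup; exact: iX1].
- exists a; split=> //; apply: hull_sup; apply/X1E; exists x0 => //.
  by rewrite -ea group_mulKr //; exact: GH.
- move=> O x OO [y [Oy hy]] hx.
  have OX1 : O `&` X1 !=set0.
    apply: contrapT => n; suff : hull B X1 `<=` ~` O by move=> /(_ y hy).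
    by apply: hull_min => // z Xz Oz; apply: n; exists z.
  apply: contrapT => nO.
  (* Whether an orbit avoids [O] depends only on the type of the point over [B], so [x] may be
     replaced by a point of [X1], where orbits are dense. *)
  have [z Xz xz] := hull_same_type sB sB' tX1 hx.
  have tav := type_definable_avoid sB sGam GamB OO.
  have [|_ nz] := type_definable_same_type tav xz.
    split; first by apply: (hull_min (type_definable_H H_def B) X1H hx).
    by move=> c Gc Oc; apply: nO; exists c.
  have [c Gc] := X1trans O z (type_open_subset BB' OO) OX1 Xz.
  exact: nz.
Qed.

End Flows.

(** * Choquet games *)

Section StoneOpen.
Context (L : language) (C : Type) (S : structure L C) (A : set C) (I : Type).

Lemma open_stoneE (U : set (stone S A I)) :
  open U -> exists D, U = \bigcup_(phi in D) stone_basic phi.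
Proof. by move=> [D _ <-]; exists D. Qed.

Lemma open_stone_basic (phi : formula L (I + A)) :
  open (stone_basic phi : set (stone S A I)).
Proof. by exists [set phi] => //; rewrite bigcup_set1. Qed.

Lemma type_open_tp (U : set (stone S A I)) :
  open U -> type_open S A [set a | U (tp S A a)].
Proof.
move=> /open_stoneE[D ->].
rewrite (_ : mkset _ = \bigcup_(phi in D) realizations S phi).
  by apply: type_open_bigcup => phi _; exact: type_open_realizations.
by apply/seteqP; split.
Qed.

Lemma open_types_inE (Y : set (I -> C)) (U : set (types_in S A Y)) :
  open U <-> exists2 U' : set (stone S A I), open U' & set_val @^-1` U' = U.
Proof. by []. Qed.

Lemma open_types_in (Y O : set (I -> C)) : type_open S A O ->
  open [set q : types_in S A Y | exists a, tp S A a = set_val q /\ O a].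
Proof.
move=> OO; apply/open_types_inE.
exists (\bigcup_(phi in [set phi | realizations S phi `<=` O]) stone_basic phi).
  by apply: bigcup_open => phi _; exact: open_stone_basic.
apply/seteqP; split=> q /=.
  move=> [phi phiO qphi]; have [a Ya e] := set_val_in q; exists a; split=> //.
  by apply: phiO; move: qphi; rewrite -e.
move=> [a [e Oa]]; have [phi phia phiO] := type_open_nbhs OO Oa.
by exists phi => //; rewrite -e.
Qed.

End StoneOpen.

Section Games.
Context (L : language) (C : Type) (S : structure L C) (K : Type).
Context (K_inf : small K [set: nat]) (S_sat : saturated K S).
Context (I : Type) (I_small : small K [set: I]).
Implicit Types (A : set C) (G X Y : set (I -> C)) (W : nat -> set (I -> C)).

(* A Choquet game on [Y] in which the points played by A must lie in [G].  The
   type [P] collects the positions and [D p] is the last move of B. *)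
Definition winnable A G Y : Prop :=
  exists (P : Type) (D : P -> set (I -> C)) (p0 : P) (step : P -> P -> Prop),
    [/\ D p0 = setT,
        forall p O x, type_open S A O -> O x -> G x -> O `<=` D p ->
          exists p', [/\ step p p', type_open S A (D p'), D p' x & D p' `<=` O] &
        forall p : nat -> P, p 0 = p0 -> (forall n, step (p n) (p n.+1)) ->
          exists2 y, Y y & forall n, D (p n) y].

(* [X] witnesses that the [W n] are nowhere dense in a way that survives
   refining the game: every open set meeting [X] contains points of [G] in [X]
   outside of [W n]. *)
Definition spread A G W X : Prop :=
  [/\ X !=set0, type_definable S A X &
      forall O n, type_open S A O -> O `&` X !=set0 ->
        exists x, [/\ O x, X x, G x & ~ W n x]].

(** In round [n] player A moves into [Q n], at a point of [G] in [X] supplied by [spread]. The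
    answer of B contains this point, so it still meets [X] and the game continues. *)
Lemma winnable_Baire A G W X Y (Q : nat -> set (I -> C)) :
  winnable A G Y -> spread A G W X ->
  (forall n, type_open S A (Q n)) ->
  (forall O n, type_open S A O -> O `&` X !=set0 -> O `&` Q n `&` X !=set0) ->
  exists2 y, Y y & forall n, Q n y.
Proof.
move=> [P [D [p0 [step [Dp0 D_step D_run]]]]] [[x0 Xx0] tX sX] QO Qd.
have /choice[f fE] (z : nat * P) : exists p', type_open S A (D z.2) ->
    D z.2 `&` X !=set0 -> [/\ step z.2 p', type_open S A (D p'),
      D p' `&` X !=set0 & D p' `<=` Q z.1].
  case: z => n p /=.
  have [[OD DX]|nn] := pselect (type_open S A (D p) /\ D p `&` X !=set0); last first.
    by exists p => OD DX; case: nn.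
  have OQ := type_openI OD (QO n).
  have [x [Ox Xx Gx _]] := sX _ 0 OQ (Qd _ n OD DX).
  have [|p' [st Op' p'x p'O]] := D_step p _ x OQ Ox Gx; first by move=> y [].
  by exists p' => _ _; split=> //; [exists x|move=> y /p'O[]].
pose run := fix run n := if n is k.+1 then f (k, run k) else p0.
have runE n : type_open S A (D (run n)) /\ D (run n) `&` X !=set0.
  elim: n => [|n [OD DX]] /=; last by have [] := fE (n, run n) OD DX.
  by rewrite Dp0; split; [exact: type_openT|exists x0].
have runS n : step (run n) (run n.+1) /\ D (run n.+1) `<=` Q n.
  by have [OD DX] := runE n; have [] := fE (n, run n) OD DX.
have [y Yy Dy] := D_run run erefl (fun n => (runS n).1).
by exists y => // n; apply: (runS n).2; exact: Dy.
Qed.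

Lemma winnable_self A G W X : (forall n, type_definable S A (W n)) ->
  spread A G W X -> G = \bigcup_n W n -> ~ winnable A G G.
Proof.
move=> tW sX GW wG.
have [|O n OO OX|y Gy nW] := winnable_Baire (Q := fun n => ~` W n) wG sX.
- by move=> n; exact: type_openC.
- by have [_ _ /(_ O n OO OX)[x [Ox Xx _ nx]]] := sX; exists x.
by move: Gy; rewrite GW => -[n _]; exact: nW.
Qed.

(* The parameters of all the [U n] need not form a small set when the cardinal of
   [K] has countable cofinality; but [W k] is type-definable without parameters,
   hence separated from the complement of [U n] by a formula without parameters. *)
Lemma winnable_Gdelta A G W F (U : nat -> set (I -> C)) : small K A ->
  pseudo_closed K S F -> (forall n, pseudo_open K S (U n)) ->
  (forall n, type_definable S set0 (W n)) -> G = \bigcup_n W n -> G !=set0 ->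
  G `<=` F `&` \bigcap_n U n -> winnable A G (F `&` \bigcap_n U n).
Proof.
move=> sA [B sB tF] UO tW GW [g0 Gg0] GY.
pose step (p p' : nat * set (I -> C)) := p'.1 = p.1.+1 /\
  exists phi : formula L (I + A), [/\ p'.2 = realizations S phi,
    realizations S phi `<=` p.2, realizations S phi `<=` U p.1 &
    realizations S phi `&` G !=set0].
exists (nat * set (I -> C))%type, snd, (0, setT), step; split=> //.
- move=> [n E] O x OO Ox Gx /= OE.
  move: (Gx); rewrite GW => -[k _ Wkx].
  have [Bn sBn tUn] := UO n.
  have [|theta [Wtheta thetaU]] :=
      type_definable_interpolation K_inf S_sat (small_countable K_inf (countable0 C))
        sBn I_small (tW k) tUn.
    apply/seteqP; split=> // y [Wy nUy]; apply: nUy.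
    by have /GY[_] : G y; [rewrite GW; exists k|exact].
  have Otheta : type_open S A (realizations S theta).
    exact: type_open_subset (sub0set A) (type_open_realizations _ _).
  have [phi phix phiO] :=
    type_open_nbhs (type_openI OO Otheta) (conj Ox (Wtheta _ Wkx)).
  exists (n.+1, realizations S phi); split=> //=.
  + split=> //; exists phi; split=> //.
    * by move=> y /phiO[/OE].
    * move=> y /phiO[_ thy]; apply: contrapT => nUy.
      suff : (realizations S theta `&` ~` U n) y by rewrite thetaU.
      by [].
    * by exists x.
  + exact: type_open_realizations.
  + by move=> y /phiO[].
- move=> p p_0 p_step.
  have p_1 n : (p n).1 = n by elim: n => [|n IH]; [rewrite p_0|rewrite (p_step n).1 IH].
  have p_mono m n : (m <= n)%N -> (p n).2 `<=` (p m).2.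
    elim: n => [|n IH]; first by rewrite leqn0 => /eqP->.
    rewrite leq_eqVlt => /orP[/eqP->//|]; rewrite ltnS => /IH mn y.
    by have [_ [phi [-> phip _ _]]] := p_step n; move=> /phip/mn.
  (* All answers of B are formulas over [A], so together with [F] they are closed over one small
     set. Finitely many of them have a common point of [G], which lies in [F]. *)
  have [|||y yE] := type_definable_compact K_inf S_sat (A := A `|` B)
      (F := fun o : option nat => if o is Some n then (p n.+1).2 else F) _ I_small.
  + exact: small_setU.
  + case=> [n|]; last by apply: type_definable_subset tF => c; right.
    have [_ [phi [-> _ _ _]]] := p_step n.
    by apply: type_definable_subset (type_definable_realizations _ _) => c; left.
  + move=> E /finite_seqP[s ->].
    pose N := \max_(o <- s) (if o is Some n then n else 0).
    have [_ [phi [e _ _ [x [phix Gx]]]]] := p_step N.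
    exists x => -[n|] /= ns; last by have [] := GY _ Gx.
    apply: (p_mono n.+1 N.+1); last by rewrite e.
    by rewrite ltnS;
      exact: (@leq_bigmax_seq _ s xpredT (fun o => if o is Some n then n else 0) _ ns).
  exists y.
    split; first exact: (yE None).
    move=> n _; have := yE (Some n); rewrite /=.
    by have [_ [phi [-> _ + _]]] := p_step n; rewrite p_1; exact.
  by case=> [|n]; [rewrite p_0|exact: (yE (Some n))].
Qed.

(** * From strong Choquet spaces of types to games on tuples *)

Section Choquet.
Context (A : set C) (Y : set (I -> C)).
Local Notation Z := (types_in S A Y).

Let point_of (y : I -> C) (Yy : Y y) : Z := elt (imageP (tp S A) Yy).

Let same_type_point (q : Z) a : tp S A a = set_val q ->
  exists2 y, Y y & same_type S A a y /\ tp S A y = set_val q.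
Proof.
move=> e; have [y Yy ey] := set_val_in q; exists y => //; split=> //.
by apply/same_type_tp; rewrite e ey.
Qed.

Lemma eq_legal_A (s : choquet_strategy Z) (O O' : nat -> set Z) (x x' : nat -> Z) n :
  (forall k, (k <= n)%N -> O k = O' k /\ x k = x' k) ->
  legal_A s O x n -> legal_A s O' x' n.
Proof.
move=> E; rewrite /legal_A; have [<- <-] := E n (leqnn _) => -[h1 h2 h3].
split=> //; case: n E h3 {h1 h2} => // n E.
suff -> : answer s O x n = answer s O' x' n by [].
rewrite /answer; congr s; apply/eq_in_map => k; rewrite mem_iota add0n => /andP[_ kn].
by have [-> ->] := E k (ltnW kn).
Qed.

(** A position is a legal history of the game on types, together with a type-open set of tuples
    whose trace on [Y] is the last answer of the strategy. *)
Lemma winnable_strong_Choquet G : G `<=` Y -> G !=set0 ->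
  strong_Choquet Z -> winnable A G Y.
Proof.
move=> GY [y0 /GY Yy0] [s s_win].
pose d : set Z * Z := (setT, point_of Yy0).
pose OO (l : seq (set Z * Z)) k := (nth d l k).1.
pose xx (l : seq (set Z * Z)) k := (nth d l k).2.
pose legal l := forall k, (k < size l)%N -> legal_A s (OO l) (xx l) k.
have answerE l k : (k < size l)%N -> answer s (OO l) (xx l) k = s (take k.+1 l).
  move=> kl; rewrite /answer; congr s.
  apply: (@eq_from_nth _ d); rewrite size_mkseq; first by rewrite size_takel.
  move=> i ik; rewrite nth_mkseq // nth_take // /OO /xx; by case: nth.
pose ok (p : seq (set Z * Z) * set (I -> C)) := [/\ legal p.1, type_open S A p.2 &
  forall y (Yy : Y y), p.2 y <-> (p.1 = [::] \/ s p.1 (point_of Yy))].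
have ok0 : ok ([::], setT) by split=> //; [exact: type_openT|split=> // _; left].
pose P := {p | ok p}.
pose step (p p' : P) := exists m, (sval p').1 = rcons (sval p).1 m.
exists P, (fun p => (sval p).2), (exist _ _ ok0), step; split=> //.
- move=> [[l E] okp] O x OO' Ox Gx /= OE.
  have [/= lp OEp Ep] := okp; have Yx := GY _ Gx.
  pose m : set Z * Z :=
    ([set q : Z | exists a, tp S A a = set_val q /\ O a], point_of Yx).
  pose l' := rcons l m.
  have E_l k : (k < size l)%N -> OO l' k = OO l k /\ xx l' k = xx l k.
    by move=> kl; rewrite /OO /xx nth_rcons kl.
  have E_m : OO l' (size l) = m.1 /\ xx l' (size l) = m.2.
    by rewrite /OO /xx nth_rcons ltnn eqxx.
  have legal_l' : legal l'.
    move=> k; rewrite size_rcons ltnS leq_eqVlt => /orP[/eqP->|kl]; last first.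
      apply: eq_legal_A (lp k kl) => j jk.
      by have [-> ->] := E_l j (leq_ltn_trans jk kl).
    have [e1 e2] := E_m; rewrite /legal_A e1 e2; split.
    + exact: open_types_in.
    + by exists x.
    + move=> q [a [e Oa]]; case el : (size l) => [//|n].
      rewrite answerE ?size_rcons ?el // /l' -cats1 take_cat el ltnn subnn take0 cats0.
      have [y Yy [ay ey]] := same_type_point e.
      have /Ep : E y by apply: type_open_same_type OEp ay _; exact: OE.
      move=> /(_ Yy)[l0|]; first by rewrite l0 in el.
      by congr (s l _); apply: set_val_inj.
  have sl' : answer s (OO l') (xx l') (size l) = s l'.
    by rewrite answerE ?size_rcons // take_oversize // size_rcons.
  have [win _] := s_win (OO l') (xx l').
  have [] := win (size l).
    by move=> k kl; apply: legal_l'; rewrite size_rcons ltnS.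
  rewrite sl'; have [-> ->] := E_m; move=> open_s sx s_O.
  (* The answer is open only in the subspace of types of [Y]. Its largest open lift to the Stone
     space, cut down to [O], has the same trace on [Y]. *)
  pose E' := O `&` \bigcup_(U in [set U | open U /\
    forall q : Z, U (set_val q) -> s l' q]) [set a | U (tp S A a)].
  have OE' : type_open S A E'.
    apply: type_openI => //; apply: type_open_bigcup => U [oU _].
    exact: type_open_tp.
  have E'E y (Yy : Y y) : E' y <-> (l' = [::] \/ s l' (point_of Yy)).
    split.
      by move=> [_ [U [_ h] Uy]]; right; exact: h.
    move=> [/(congr1 size)|sy]; first by rewrite size_rcons.
    split.
      have [a [e Oa]] := s_O _ sy.
      by apply: type_open_same_type OO' _ Oa; exact/same_type_tp.
    have [U oU e] := (open_types_inE _).1 open_s.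
    exists U; first by split=> // q; rewrite -e.
    by move: sy; rewrite -e.
  have okp' : ok (l', E') by split.
  exists (exist _ _ okp'); split=> //=.
  + by exists m.
  + by apply/(E'E x Yx); right.
  + by move=> y [].
- move=> p p_0 p_step.
  have /choice[m mE] := p_step.
  have lE n : (sval (p n)).1 = mkseq m n.
    elim: n => [|n IH]; first by rewrite p_0.
    by rewrite mE IH mkseqS.
  have [_ win] := s_win (fun n => (m n).1) (fun n => (m n).2).
  have [n|q qE] := win.
    have [lp _ _] := svalP (p n.+1); rewrite lE in lp.
    apply: eq_legal_A (lp n _); last by rewrite size_mkseq.
    by move=> k kn; rewrite /OO /xx nth_mkseq.
  have [y Yy ey] := set_val_in q; exists y => // -[|n]; first by rewrite p_0.
  have [_ _ h] := svalP (p n.+1); apply/(h y Yy); right.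
  have := qE n Logic.I; rewrite /answer lE.
  rewrite (_ : mkseq (fun i => _) _ = mkseq m n.+1); last first.
    by apply: eq_mkseq => i; case: (m i).
  by congr (s _ _); exact: set_val_inj.
Qed.

End Choquet.

End Games.

(** * The word balls are nowhere dense in a minimal flow *)

Record filtration (L : language) (C : Type) (S : structure L C) (I : Type)
    (H : set (I -> C)) (g : group_on H) (G : set (I -> C))
    (W : nat -> set (I -> C)) : Prop := Filtration {
  filtration_td : forall n, type_definable S set0 (W n);
  filtrationS : forall m n, (m <= n)%N -> W m `<=` W n;
  filtrationM : forall m n x y, W m x -> W n y -> W (m + n) (Defs.mul g x y);
  filtrationV : forall n x, W n x -> W n (Defs.inv g x);
  filtrationE : G = \bigcup_n W n;
  filtration_subgroup : subgroup g G }.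

Section Generation.
Context (L : language) (C : Type) (S : structure L C) (K : Type).
Context (K_inf : small K [set: nat]) (S_sat : saturated K S).
Context (I : Type) (I_small : small K [set: I]) (H : set (I -> C)).
Context (g : group_on H) (H_def : type_definable_group S g).
Local Notation "x ** y" := (Defs.mul g x y) (at level 40, left associativity).
Local Notation one := (Defs.one g).
Local Notation inv := (Defs.inv g).

Lemma word_ball_filtration (V : nat -> set (I -> C)) :
  (forall n, V n `<=` H) -> (forall n, type_definable S set0 (V n)) ->
  filtration S g (generated g (\bigcup_n V n)) (word_ball g V).
Proof.
move=> VH tV.
have s0 : small K (@set0 C) by apply: small_countable => //; exact: countable0.
have VH' : \bigcup_n V n `<=` H by move=> x [n _ /VH].
split.
- move=> n; rewrite /word_ball.
  have tB m : type_definable S set0 (letters g V m).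
    elim: m => [|m IH].
      rewrite (_ : letters _ _ _ = set0); first exact: type_definable0.
      by apply/seteqP; split=> // x [].
    rewrite (_ : letters _ _ _ = letters g V m `|` (V m `|` inv_set g (V m))).
      apply: type_definableU => //; apply: type_definableU => //.
      exact: (type_definable_inv K_inf S_sat).
    apply/seteqP; split=> x.
      move=> [k /=]; rewrite ltnS leq_eqVlt => /orP[/eqP->|km xk]; first by right.
      by left; exists k.
    move=> [[k /= km xk]|h]; first by exists k => //=; exact: leqW.
    by exists m; [exact: ltnSn|exact: h].
  (* The induction concerns the exponent alone; the alphabet stays [letters g V n]. *)
  elim: {2}n => [|k IH]; first exact: (type_definable_one H_def s0).
  rewrite (_ : power _ _ _ = [set one] `|`
      prod_set g (letters g V n) (power g (letters g V n) k)).
    apply: type_definableU; first exact: (type_definable_one H_def s0).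
    apply: (type_definable_prod K_inf S_sat) => //; first exact: letters_sub.
    by apply: power_sub; exact: letters_sub.
  by apply/seteqP; split.
- by move=> m n; exact: word_ballS.
- by move=> m n x y; exact: word_ball_mul.
- by move=> n x; exact: word_ball_inv.
- exact: generated_word_ball.
- exact: subgroup_generated.
Qed.

Lemma generated_of_word_ball (V : nat -> set (I -> C)) (G : set (I -> C)) n :
  (forall n, V n `<=` H) -> G `<=` word_ball g V n ->
  generated_in_finitely_many_steps g V G.
Proof.
by move=> VH GW; exists n, n => x /GW; apply: power_seq; exact: letters_sub.
Qed.

Lemma small_model_exists (A : set C) : small K [set: func L] ->
  small K [set: rel_sym L] -> small K A ->
  exists2 M, A `<=` M & small_model K S M.
Proof.
move=> sF sR /small_setT sA.
have [U [sU U_inf FRU AU]] := small_max K_inf (small_sum K_inf sF sR) sA.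
have [||M [AM elM MU]] := downward_Lowenheim_Skolem S U_inf _ _ AU.
- by apply: embeds_trans FRU; exists inl => x y [].
- by apply: embeds_trans FRU; exists inr => x y [].
exists M => //; split=> //; apply/small_setT; exact: small_embeds MU sU.
Qed.

Section Filtered.
Context (G : set (I -> C)) (W : nat -> set (I -> C)).
Context (GW : filtration S g G W).

Let GH : G `<=` H. Proof. by have [] := filtration_subgroup GW. Qed.

Let G1 : G one. Proof. by have [] := filtration_subgroup GW. Qed.

Let WG n : W n `<=` G.
Proof. by move=> x Wx; rewrite (filtrationE GW); exists n. Qed.

Let W_ratio n k x y : H x -> W n (x ** y) -> W k y -> W (n + k) x.
Proof.
move=> Hx Wxy Wy; have Hy : H y by exact/GH/WG/Wy.
rewrite -(group_mulKr g Hx Hy); apply: (filtrationM GW) => //.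
exact: (filtrationV GW).
Qed.

(** One point of [G] outside each [W n] generates such a group. Being countable, it has few enough
    coordinates to be used as parameters. *)
Lemma unbounded_countable_subgroup : (forall n, ~ G `<=` W n) ->
  exists Gam, [/\ subgroup g Gam, Gam `<=` G, countable Gam &
    forall n, ~ Gam `<=` W n].
Proof.
move=> unb.
have /choice[h hE] n : exists x, G x /\ ~ W n x.
  apply: contrapT => nx; apply: (unb n) => x Gx; apply: contrapT => nWx.
  by apply: nx; exists x.
have hH : range h `<=` H by move=> _ [n _ <-]; apply: GH; have [] := hE n.
exists (\bigcup_k power g (symmetrization g (range h)) k); split.
- exact: subgroup_bigcup_power.
- have [_ _ _ GV] := filtration_subgroup GW.
  move=> x [k _]; apply: power_subgroup_sub; first exact: filtration_subgroup GW.
  have hG : range h `<=` G by move=> _ [n _ <-]; have [] := hE n.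
  by move=> y [/hG//|[z /hG Gz <-]]; exact: GV.
- apply: bigcup_countable => [|k _]; first exact: countableP.
  apply: countable_power; rewrite /symmetrization -bigcup2E.
  have ch : countable (range h).
    exact: sub_countable (card_image_le _ _) (countableP _).
  apply: bigcup_countable => [|[|[|n]] _] //=.
  exact: sub_countable (card_image_le _ _) ch.
- move=> n /(_ (h n)); have [_ nW] := hE n => h'; apply/nW/h'.
  exists 1 => //=; right; exists (h n), one; split=> //; first by left; exists n.
  by rewrite mul_one //; apply: hH; exists n.
Qed.

Section Flow.
Context (Gam : set (I -> C)) (Gam_sub : subgroup g Gam) (Gam_G : Gam `<=` G).
Context (Gam_unb : forall n, ~ Gam `<=` W n).
Context (A : set C) (A_small : small K A) (Gam_A : coordinates Gam `<=` A).

(* If [O `&` X] were inside [W n], then finitely many translates of it would cover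
   [X], so that [X], and with it [Gam], would be inside some [W m]. *)
Lemma spread_of_flow X : X `<=` H -> type_definable S A X ->
  invariant_under g Gam X -> X `&` G !=set0 -> transitive_under S g A Gam X ->
  spread S A G W X.
Proof.
move=> XH tX iX [x0 [Xx0 Gx0]] trX; split=> [||O n OO OX]; [by exists x0|by []|].
have GamH : Gam `<=` H by move=> c /Gam_G/GH.
(* This set is open, and the orbit of [x0] stays in [G] and is dense in [X], so it suffices that the
   set meets [X] at any point. *)
suff : (O `\` W n) `&` X !=set0.
  have OD : type_open S A (O `\` W n).
    apply: type_openD => //; apply: type_definable_subset (filtration_td GW n).
    exact: sub0set.
  move=> /(trX _ _ OD)/(_ Xx0)[c Gc [Oc nWc]]; exists (c ** x0); split=> //.
    exact: iX.
  by have [_ _ GM _] := filtration_subgroup GW; apply: GM => //; exact: Gam_G.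
apply: contrapT => nOX.
have OW x : O x -> X x -> W n x.
  by move=> Ox Xx; apply: contrapT => nWx; apply: nOX; exists x.
pose F (o : option (I -> C)) : set (I -> C) := match o with
  | Some c => [set x | Gam c -> H x /\ (~` O) (c ** x)] | None => X end.
have [E [E_fin E_empty]] : exists E, finite_set E /\
    forall x, ~ forall o, E o -> F o x.
  apply: contrapT => /forallNP nE.
  have [|o|E E_fin|x xF] :=
    type_definable_compact K_inf S_sat (F := F) (A := A) _ I_small.
  - exact: A_small.
  - case: o => [c|//] /=; have [Gc|nGc] := pselect (Gam c).
      rewrite (_ : mkset _ = [set x | H x /\ (~` O) (c ** x)]).
        exact: (type_definable_translate K_inf S_sat I_small H_def A_small Gam_sub).
      by apply/seteqP; split=> x /= h; [exact: h|].
    rewrite (_ : mkset _ = setT); first exact: type_definableT.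
    by apply/seteqP; split=> // x _ /nGc.
  - by have := nE E; rewrite not_andP => -[//|/existsNP[x /contrapT xE]]; exists x.
  have [c Gc Oc] := trX O x OO OX (xF None).
  by have [_ /(_ Oc)] := xF (Some c) Gc.
have [k kE] : exists k, forall c, E (Some c) -> Gam c -> W k c.
  move: E_fin => /(@finite_seqP {classic option (I -> C)})[s ->] {E_empty E}.
  elim: s => [|[c|] s [k IH]]; first by exists 0.
  - have [/Gam_G|nGc] := pselect (Gam c); last first.
      exists k => d /=; rewrite inE => /orP[/eqP[->] /nGc//|]; exact: IH.
    rewrite (filtrationE GW) => -[j _ Wc].
    exists (maxn j k) => d /=; rewrite inE => /orP[/eqP[->] _|sd Gd].
      by apply: (filtrationS GW) Wc; exact: leq_maxl.
    by apply: (filtrationS GW) (IH d sd Gd); exact: leq_maxr.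
  - by exists k => d /=; rewrite inE => /orP[/eqP//|]; exact: IH.
have XW x : X x -> W (k + n) x.
  move=> Xx; have Hx := XH _ Xx.
  have /existsNP[[c|] /not_implyP[Ec nF]] := E_empty x; last by case: nF.
  have /not_implyP[Gc nO] := nF.
  have Oc : O (c ** x) by apply: contrapT => h; apply: nO.
  rewrite -(group_mulKl g (GamH _ Gc) Hx); apply: (filtrationM GW).
    by apply: (filtrationV GW); exact: kE.
  by apply: OW => //; exact: iX.
(* [c] is the quotient of [c ** x0] by [x0], both in [X] and hence in [W (k + n)]. *)
apply: (Gam_unb (n := (k + n) + (k + n))) => c Gc.
apply: W_ratio (XW _ Xx0); first exact: GamH.
exact/XW/iX.
Qed.

End Flow.

Lemma type_definable_bound n : G `<=` W n -> pseudo_closed K S G.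
Proof.
move=> GWn; exists set0; first by apply: small_countable => //; exact: countable0.
rewrite (_ : G = W n); first exact: filtration_td GW n.
by apply/seteqP; split=> //; exact: WG.
Qed.

Lemma bounded_of_pseudo_closed : pseudo_closed K S G -> exists n, G `<=` W n.
Proof.
move=> cG; have [B sB tG] := cG; apply: contrapT => /forallNP unb.
have [Gam [sGam GamG cGam Gam_unb]] := unbounded_countable_subgroup unb.
pose A := B `|` coordinates Gam.
have sA : small K A.
  apply: small_setU => //; apply: (small_coordinates K_inf I_small).
  exact: small_countable.
have GamA : coordinates Gam `<=` A by move=> c; right.
have [GH' _ GM _] := filtration_subgroup GW.
have fG : is_flow S g A Gam G.
  split; [|by exists one|by move=> c x /GamG Gc Gx; exact: GM].
  by apply: type_definable_subset tG => c; left.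
have [X [XG fX Xmin]] :=
  minimal_flow K_inf S_sat I_small sA GH fG.
have XH : X `<=` H by move=> x /XG/GH.
have [tX [x Xx] iX] := fX.
have sX : spread S A G W X.
  apply: (spread_of_flow sGam GamG Gam_unb sA GamA XH tX iX).
    by exists x; split=> //; exact: XG.
  exact: (minimal_flow_transitive K_inf S_sat I_small H_def sA sGam GamA XH fX).
have GE : G = G `&` \bigcap_(n : nat) setT.
  by apply/seteqP; split=> [y Gy|y []//]; split.
have wG : winnable S A G (G `&` \bigcap_(n : nat) setT).
  apply: (winnable_Gdelta K_inf S_sat I_small sA cG _ (filtration_td GW)
    (filtrationE GW)).
  - move=> n; exists set0; first by apply: small_countable => //; exact: countable0.
    by rewrite setCT; exact: type_definable0.
  - by exists one.
  - by rewrite -GE.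
rewrite -GE in wG; apply: (winnable_self _ sX (filtrationE GW) wG).
by move=> n; apply: type_definable_subset (filtration_td GW n); exact: sub0set.
Qed.

End Filtered.
End Generation.

(** * Pseudo closedness and the number of cosets *)

Section Consequences.
Context (L : language) (C : Type) (S : structure L C) (K : Type).
Context (K_inf : small K [set: nat]) (S_sat : saturated K S).
Context (K_func : small K [set: func L]) (K_rel : small K [set: rel_sym L]).
Context (I : Type) (I_small : small K [set: I]) (H : set (I -> C)).
Context (g : group_on H) (H_def : type_definable_group S g).
Context (G : set (I -> C)) (W : nat -> set (I -> C)).
Context (GW : filtration S g G W).
Local Notation "x ** y" := (Defs.mul g x y) (at level 40, left associativity).
Local Notation one := (Defs.one g).
Local Notation inv := (Defs.inv g).

Let GH : G `<=` H. Proof. by have [] := filtration_subgroup GW. Qed.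

Let G1 : G one. Proof. by have [] := filtration_subgroup GW. Qed.

Let G0 : G !=set0. Proof. by exists one. Qed.

Let small0 : small K (@set0 C).
Proof. by apply: small_countable => //; exact: countable0. Qed.

Lemma pseudo_openT : pseudo_open K S [set: I -> C].
Proof. by exists set0 => //; rewrite setCT; exact: type_definable0. Qed.

Lemma pseudo_closedT : pseudo_closed K S [set: I -> C].
Proof. by exists set0 => //; exact: type_definableT. Qed.

Lemma winnable_of_pseudo M Y : small_model K S M -> G `<=` Y ->
  [\/ pseudo_Gdelta K S Y, pseudo_closed K S Y | pseudo_strong_Choquet K S Y] ->
  winnable S M G Y.
Proof.
move=> sM GY; have [sM1 _] := sM; case=> [[U UO YE]|cY|cY].
- rewrite YE -[\bigcap_n U n]setTI.
  apply: (winnable_Gdelta K_inf S_sat I_small sM1 pseudo_closedT UO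
    (filtration_td GW) (filtrationE GW)) => //.
  by rewrite setTI -YE.
- rewrite (_ : Y = Y `&` \bigcap_(n : nat) setT); last first.
    by apply/seteqP; split=> [y Yy|y []//]; split.
  apply: (winnable_Gdelta K_inf S_sat I_small sM1 cY _
    (filtration_td GW) (filtrationE GW)) => //.
    by move=> n; exact: pseudo_openT.
  by move=> y Gy; split=> //; exact: GY.
- exact: winnable_strong_Choquet (cY M sM).
Qed.

Lemma filtration_td_over A n : type_definable S A (W n).
Proof. exact: type_definable_subset (sub0set A) (filtration_td GW n). Qed.

Section Unbounded.
Context (G_unb : forall n, ~ G `<=` W n) (G_index : small K (cosets g G H)).

(** [Gam] is fixed before the parameters, so that [A] can be taken to be a model containing its
    coordinates, and a countable one for smoothness. *)
Lemma invariant_spread : exists Gam, [/\ subgroup g Gam, Gam `<=` G, countable Gam &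
  forall A, small K A -> coordinates Gam `<=` A -> exists X,
    [/\ X `<=` H, invariant_under g Gam X, transitive_under S g A Gam X &
      spread S A G W X]].
Proof.
have [Gam [sGam GamG cGam Gam_unb]] := unbounded_countable_subgroup GW G_unb.
exists Gam; split=> // A sA GamA.
have [X [XH tX iX XG trX]] := flow_in_bounded_index K_inf S_sat I_small H_def sA
  (filtration_subgroup GW) G_index sGam GamG GamA.
exists X; split=> //.
exact: (spread_of_flow K_inf S_sat I_small H_def GW sGam GamG Gam_unb sA GamA).
Qed.

Lemma model_spread B : small K B -> exists M X,
  [/\ small_model K S M, B `<=` M, X `<=` H & spread S M G W X].
Proof.
move=> sB; have [Gam [_ _ cGam ex]] := invariant_spread.
have [|M BM sM] := small_model_exists S K_inf K_func K_rel (A := B `|` coordinates Gam).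
  apply: small_setU => //; apply: (small_coordinates K_inf I_small).
  exact: small_countable.
have [||X [XH _ _ sX]] := ex M; first by have [] := sM.
  by move=> c h; apply: BM; right.
by exists M, X; split=> // c h; apply: BM; left.
Qed.

End Unbounded.

Lemma bounded_of_pseudo : small K (cosets g G H) ->
  [\/ pseudo_Gdelta K S G, pseudo_closed K S G | pseudo_strong_Choquet K S G] ->
  exists n, G `<=` W n.
Proof.
move=> idx pG; apply: contrapT => /forallNP unb.
have [M [X [sM _ _ sX]]] := model_spread unb idx small0.
apply: (winnable_self _ sX (filtrationE GW)).
  by move=> n; exact: filtration_td_over.
exact: winnable_of_pseudo.
Qed.

(* The types over [set0] cover everything, and none of them contains an open part
   of [X]: such a part would meet [G], and its type would then lie in some [W n]. *)
Lemma type_countable_bounded : small K (cosets g G H) -> small_theory S ->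
  finite_set [set: I] -> exists n, G `<=` W n.
Proof.
move=> idx sT [m Im]; apply: contrapT => /forallNP unb.
have [M [X [sM _ XH sX]]] := model_spread unb idx small0.
(* [small_theory] counts types in the variables ['I_m], so the finite index type is renumbered. *)
have [r [f rf]] : exists (r : 'I_m -> I) (f : I -> 'I_m), forall i, r (f i) = i.
  have /card_set_bijP[f [f_fun f_inj f_surj]] := Im.
  have fm i : (f i < m)%N by exact: f_fun.
  have /choice[r rE] (k : 'I_m) : exists i, f i = k.
    by have [i _ <-] := f_surj k (ltn_ord k); exists i.
  exists r, (fun i => Ordinal (fm i)) => i.
  by apply: f_inj; rewrite ?in_setT // rE.
have /card_leTE[code code_inj] := sT m.
pose E k := [set a : I -> C | code (tp S set0 (a \o r)) = k].
have E_same k a b : E k a -> E k b -> forall n, W n a -> W n b.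
  move=> <- /code_inj/esym/same_type_tp ab n.
  have tW : type_definable S set0 [set c : 'I_m -> C | W n (c \o f)].
    exact/type_definable_preimage/(filtration_td GW).
  have rfE (x : I -> C) : (x \o r) \o f = x by apply/funext => i /=; rewrite rf.
  by have := type_definable_same_type tW ab; rewrite /= !rfE.
have tE k : type_definable S M (E k).
  apply: type_definable_subset (sub0set M) _.
  have [[a Ea]|nE] := pselect (E k !=set0); last first.
    rewrite (_ : E k = set0); first exact: type_definable0.
    by apply/seteqP; split=> // a Ea; case: nE; exists a.
  rewrite (_ : E k = [set b : I -> C |
      (\bigcap_(phi in [set phi | holds S phi (a \o r)])
      @realizations _ _ S set0 'I_m phi) (b \o r)]).
    apply/type_definable_preimage/type_definable_bigcap => phi _.
    exact: type_definable_realizations.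
  apply/seteqP; split=> b.
    rewrite /E /= -Ea => /code_inj/esym/same_type_tp ab phi; exact: ab.
  move=> h; rewrite /E /= -Ea; congr code; apply/esym/same_type_tp => phi.
  exact: h.
(* The game is played on all tuples; a run that avoids every [E k] would end in a tuple without a
   type over the empty set. *)
have wT : winnable S M G setT.
  by apply: winnable_of_pseudo => //; apply: Or32; exact: pseudo_closedT.
have [|O k OO OX|y _ nE] := winnable_Baire (Q := fun k => ~` E k) wT sX.
- by move=> k; exact: type_openC.
- have [_ _ s] := sX.
  have [x [Ox Xx Gx _]] := s O 0 OO OX.
  move: Gx; rewrite (filtrationE GW) => -[n _ Wx].
  have [z [Oz Xz _ nWz]] := s O n OO OX.
  have [Ex|nEx] := pselect (E k x); last by exists x.
  by exists z; split=> //; split=> // Ez; apply/nWz/(E_same k x z).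
- exact: (nE (code (tp S set0 (y \o r)))).
Qed.

(** * A Cantor scheme of pairwise distinct cosets *)

Section Cosets.
Context (A : set C) (A_small : small K A) (X : set (I -> C)) (X_H : X `<=` H).
Context (X_spread : spread S A G W X).

(** Points of [H] lie in different cosets of [G] exactly when they are far for every [n], so cosets
    can be separated one scale at a time. *)
Definition far (n : nat) (a b : I -> C) : Prop := forall w, W n w -> a <> w ** b.

Let WH n : W n `<=` H.
Proof. by move=> x Wx; apply: GH; rewrite (filtrationE GW); exists n. Qed.

Let ratio n : set (I + I -> C) :=
  [set c : I + I -> C | [/\ H (c \o inl), H (c \o inr) &
    exists2 w, W n w & c \o inl = w ** (c \o inr)]].

Let ratio_td n : type_definable S A (ratio n).
Proof.
by apply: (type_definable_ratio K_inf S_sat) => //; exact: filtration_td_over.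
Qed.

(* All points are taken in [G], so that each lies in some [W k]; a further point
   outside of [W (n + k)] is then [W n]-far from the earlier ones. *)
Lemma far_points (J : eqType) (s : seq J) (D : J -> set (I -> C)) n :
  (forall j, j \in s -> type_open S A (D j) /\ D j `&` X !=set0) ->
  exists (x : J -> I -> C) k,
    (forall j, j \in s -> [/\ D j (x j), X (x j), G (x j) & W k (x j)]) /\
    (forall i j, i \in s -> j \in s -> i != j -> forall a b,
       same_type S A (x i) a -> same_type S A (x j) b -> ~ ratio n (join2 a b)).
Proof.
have [_ _ sX] := X_spread.
elim: s => [|j s IH] Ds; first by exists (fun=> one), 0.
have [|x [k [xE x_far]]] := IH; first by move=> i si; apply: Ds; rewrite inE si orbT.
have [js|njs] := boolP (j \in s).
  exists x, k; split=> [i|i i']; rewrite !inE.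
    by move=> /orP[/eqP->|]; exact: xE.
  move=> hi hi'; apply: x_far; [case/orP: hi => [/eqP->|]//|].
  by case/orP: hi' => [/eqP->|].
have [OD DX] := Ds j (mem_head _ _).
have [y [Dy Xy Gy nWy]] := sX _ (n + k) OD DX.
have [l _ Wly] : (\bigcup_n W n) y by rewrite -(filtrationE GW).
pose x' i := if i == j then y else x i.
have x'j : x' j = y by rewrite /x' eqxx.
have x's i : i \in s -> x' i = x i.
  by move=> si; rewrite /x'; case: eqP => // ij; rewrite -ij si in njs.
have W_same m a b : same_type S A a b -> W m a -> W m b.
  exact: type_definable_same_type (filtration_td_over A m).
exists x', (maxn k l); split.
  move=> i; rewrite inE => /orP[/eqP->|si].
    by rewrite x'j; split=> //; exact: (filtrationS GW (leq_maxr k l) Wly).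
  have [? ? ? Wx] := xE i si; rewrite x's //; split=> //.
  exact: (filtrationS GW (leq_maxl k l) Wx).
move=> i i'; rewrite !inE => /orP[/eqP->|si] /orP[/eqP->|si'] ii' a b.
- by rewrite eqxx in ii'.
- rewrite x'j x's // => ya xb [_ _ [w Ww e]]; apply: nWy.
  apply: (W_same _ a); first exact: same_type_sym.
  rewrite (_ : a = w ** b) //; apply: (filtrationM GW) => //.
  by apply: W_same xb _; have [] := xE i' si'.
- rewrite x'j x's // => xa yb [Ha Hb [w Ww e]]; apply: nWy.
  apply: (W_same _ b); first exact: same_type_sym.
  have -> : b = inv w ** a.
    rewrite (_ : a = w ** b) // group_mulKl //; exact: WH Ww.
  apply: (filtrationM GW); first exact: (filtrationV GW).
  by apply: W_same xa _; have [] := xE i si.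
- by rewrite !x's //; exact: x_far.
Qed.

(** Compactness spreads farness from two types to a formula in each; as [s] is finite, the formulas
    for all pairs can be imposed together. *)
Lemma far_open_sets (J : eqType) (s : seq J) (D : J -> set (I -> C)) n :
  (forall j, j \in s -> type_open S A (D j) /\ D j `&` X !=set0) ->
  exists (O : J -> set (I -> C)) (x : J -> I -> C),
    (forall j, j \in s -> [/\ type_open S A (O j), O j (x j), X (x j), G (x j) &
       O j `<=` D j]) /\
    (forall i j, i \in s -> j \in s -> i != j -> forall a b,
       O i a -> O j b -> H a -> H b -> far n a b).
Proof.
move=> Ds; have [x [k [xE x_far]]] := far_points n Ds.
have /choice[f fE] (p : J * J) :
    exists q : formula L (I + A) * formula L (I + A),
    p.1 \in s -> p.2 \in s -> p.1 != p.2 ->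
    [/\ holds S q.1 (x p.1), holds S q.2 (x p.2) & forall a b,
      holds S q.1 a -> holds S q.2 b -> ~ ratio n (join2 a b)].
  have [[[s1 s2] ne]|nn] :=
    pselect ((p.1 \in s /\ p.2 \in s) /\ p.1 != p.2); last first.
    by exists (Bot, Bot) => s1 s2 ne; case: nn.
  have [phi [psi [h1 h2 h3]]] := type_definable_separation K_inf S_sat A_small
    I_small (ratio_td n) (x_far _ _ s1 s2 ne).
  by exists (phi, psi).
pose N i := [set a | forall j, j \in s ->
  (if i == j then setT else realizations S (f (i, j)).1 `&`
     realizations S (f (j, i)).2) a].
exists (fun i => D i `&` N i), x; split=> [i si|i j si sj ij a b].
  have [Dx Xx Gx _] := xE i si; have [OD _] := Ds i si; split=> //.
  - apply: type_openI => //; apply: type_open_forall_in => j sj.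
    case: eqP => _; first exact: type_openT.
    by apply: type_openI; exact: type_open_realizations.
  - split=> // j sj; case: eqP => [//|/eqP ij]; split.
      by have [] := fE (i, j) si sj ij.
    by have [] := fE (j, i) sj si; rewrite //= eq_sym.
move=> [_ /(_ j sj) hi] [_ /(_ i si) hj] Ha Hb w Ww e; move: hi hj.
rewrite (negPf ij) eq_sym (negPf ij) => -[h1 _] [_ h2].
by have [_ _ /(_ a b h1 h2)[]] := fE (i, j) si sj ij; split=> //; exists w.
Qed.

Let words n : seq (seq bool) := [seq val t | t <- enum {: n.-tuple bool}].

Let mem_words n w : (w \in words n) = (size w == n).
Proof.
apply/mapP/eqP => [[t _ ->]|wn]; first exact: size_tuple.
by move/eqP: wn => wn; exists (Tuple wn); rewrite ?mem_enum.
Qed.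

(** One game is played along each branch of the binary tree. Positions of level [n.+1] are chosen
    simultaneously, so that distinct words get sets that are far at scale [n]. *)
Lemma continuum_cosets Y : Y `<=` H -> winnable S A G Y ->
  [set: nat -> bool] #<= cosets g G Y.
Proof.
move=> YH [P [D [p0 [step [Dp0 D_step D_run]]]]].
pose good n (F : seq bool -> P) := forall w, size w = n ->
  type_open S A (D (F w)) /\ D (F w) `&` X !=set0.
have /choice[h hE] (z : nat * (seq bool -> P)) : exists F', good z.1 z.2 ->
    [/\ good z.1.+1 F',
        forall w, size w = z.1.+1 -> step (z.2 (take z.1 w)) (F' w) &
        forall w w', size w = z.1.+1 -> size w' = z.1.+1 -> w <> w' ->
          forall a b, D (F' w) a -> D (F' w') b -> H a -> H b -> far z.1 a b].
  case: z => n F /=; have [gF|nF] := pselect (good n F); last by exists F.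
  have [|O [x [OE O_far]]] := @far_open_sets _ (words n.+1)
      (fun w => D (F (take n w))) n.
    move=> w; rewrite mem_words => /eqP wn; apply: gF.
    by rewrite size_takel // wn.
  have /choice[F' F'E] w : exists p', size w = n.+1 ->
      [/\ step (F (take n w)) p', type_open S A (D p'), D p' (x w) & D p' `<=` O w].
    have [wn|nw] := pselect (size w = n.+1); last by exists p0.
    have [|OO Ox _ Gx OD] := OE w; first by rewrite mem_words wn.
    have [p' hp'] := D_step _ _ _ OO Ox Gx OD.
    by exists p'.
  exists F' => _; split.
  - move=> w wn; have [_ Op px _] := F'E w wn; split=> //; exists (x w); split=> //.
    by have [|] := OE w; first by rewrite mem_words wn.
  - by move=> w wn; have [] := F'E w wn.
  - move=> w w' wn wn' ww' a b; have [_ _ _ h1] := F'E w wn.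
    have [_ _ _ h2] := F'E w' wn'; move=> /h1 Oa /h2 Ob.
    by apply: O_far Oa Ob; rewrite ?mem_words ?wn ?wn' //; exact/eqP.
pose F := fix F n := if n is k.+1 then h (k, F k) else fun=> p0.
have [[x0 Xx0] _ _] := X_spread.
have gF n : good n (F n).
  elim: n => [|n IH] /=; last by have [] := hE (n, F n) IH.
  by move=> w _; rewrite Dp0; split; [exact: type_openT|exists x0].
have /choice[y yE] (e : nat -> bool) : exists y, Y y /\
    forall n, D (F n (mkseq e n)) y.
  have [//|n|y Yy yD] := D_run (fun n => F n (mkseq e n)); last by exists y.
  have [_ + _] := hE (n, F n) (gF n).
  move=> /(_ (mkseq e n.+1)); rewrite size_mkseq => /(_ erefl) /=.
  by rewrite mkseqS -cats1 take_size_cat ?size_mkseq.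
have y_inj e e' : Defs.coset g G (y e) = Defs.coset g G (y e') -> e = e'.
  move=> E; apply: contrapT => ne; have [i ei] : exists i, e i <> e' i.
    by apply/existsNP => h'; apply/ne/funext.
  have [w Gw wE] : Defs.coset g G (y e') (y e).
    rewrite -E; exists one => //; apply: one_mul; apply: YH.
    by have [] := yE e.
  move: Gw; rewrite (filtrationE GW) => -[k _ Ww].
  (* At level [n.+1] the two branches have separated, as [i] is below it, and scale [n] is large
     enough for [W n] to contain [w]. *)
  pose n := maxn i k.
  have [_ _ h_far] := hE (n, F n) (gF n).
  have [Yy Dy] := yE e; have [Yy' Dy'] := yE e'.
  apply: (h_far (mkseq e n.+1) (mkseq e' n.+1) _ _ _ (y e) (y e') _ _ _ _ w) => //.
  - by rewrite size_mkseq.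
  - by rewrite size_mkseq.
  - move=> /(congr1 (fun s => nth false s i)).
    by rewrite !nth_mkseq // ltnS leq_maxl.
  - exact: (Dy n.+1).
  - exact: (Dy' n.+1).
  - exact: YH.
  - exact: YH.
  - by apply: (filtrationS GW) Ww; exact: leq_maxr.
apply/card_leE.
have yC e : cosets g G Y (Defs.coset g G (y e)) by exists (y e) => //; have [] := yE e.
exists (fun e => elt (yC (set_val e))) => e e' E; apply: set_val_inj.
exact/y_inj/(congr1 set_val E).
Qed.

End Cosets.

End Consequences.

(** * Non-smoothness *)

Lemma cantor_coordinate_open (i : nat) : open [set c : cantor_space | c i].
Proof.
pose V : set bool := [set true].
have : open ((@proj nat (fun=> bool) i) @^-1` V : set cantor_space).
  apply: open_comp; last exact: discrete_open.
  by move=> c _; exact: proj_continuous.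
congr open; apply/seteqP; split=> c //=.
Qed.

Section Smooth.
Context (L : language) (C : Type) (S : structure L C) (K : Type).
Context (K_inf : small K [set: nat]) (S_sat : saturated K S).
Context (I : Type) (I_small : small K [set: I]) (H : set (I -> C)).
Context (g : group_on H) (H_def : type_definable_group S g).
Context (G : set (I -> C)) (W : nat -> set (I -> C)).
Context (GW : filtration S g G W).
Local Notation "x ** y" := (Defs.mul g x y) (at level 40, left associativity).
Local Notation one := (Defs.one g).
Local Notation inv := (Defs.inv g).

Let GH : G `<=` H. Proof. by have [] := filtration_subgroup GW. Qed.

(** * Baire category relative to the flow [X] *)

Section Category.
Context (A : set C) (A_small : small K A).
Context (Gam : set (I -> C)) (Gam_sub : subgroup g Gam) (Gam_G : Gam `<=` G).
Context (Gam_countable : countable Gam) (Gam_A : coordinates Gam `<=` A).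
Context (X : set (I -> C)) (X_H : X `<=` H) (X_inv : invariant_under g Gam X).
Context (X_tr : transitive_under S g A Gam X) (X_spread : spread S A G W X).
Context (Y : set (I -> C)) (Y_sub : subgroup g Y) (GY : G `<=` Y).
Context (Y_win : winnable S A G Y).
Context (formulas_countable : embeds (formula L (I + A)) nat).

Definition nowhere_dense_in (D : set (I -> C)) : Prop :=
  forall O, type_open S A O -> O `&` X !=set0 -> O `&` X `&` ~` D !=set0.

(** Smallness is tested only at points of [Y]: the reduction is defined on types of [Y], and [Y] is
    where the game finds points. *)
Definition meager_in (B : set (I -> C)) : Prop :=
  exists2 D : nat -> set (I -> C),
    forall n, type_definable S A (D n) /\ nowhere_dense_in (D n) &
    Y `&` X `&` B `<=` \bigcup_n D n.

Let GamH : Gam `<=` H. Proof. by have [] := Gam_sub. Qed.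

Lemma meager_sub B B' : Y `&` X `&` B `<=` B' -> meager_in B' -> meager_in B.
Proof.
move=> BB [D DE BD]; exists D => // a [[Ya Xa] Ba]; apply: BD.
by split=> //; exact: BB.
Qed.

Lemma nowhere_dense_set0 : nowhere_dense_in set0.
Proof. by move=> O _ [x ?]; exists x; split. Qed.

Lemma meager_nowhere_dense D : type_definable S A D -> nowhere_dense_in D ->
  meager_in D.
Proof. by move=> tD nD; exists (fun=> D) => // a [_ Da]; exists 0. Qed.

Lemma meager_bigcup (B : nat -> set (I -> C)) :
  (forall n, meager_in (B n)) -> meager_in (\bigcup_n B n).
Proof.
move=> mB; have /choice[D DE] n : exists D : nat -> set (I -> C),
    (forall k, type_definable S A (D k) /\ nowhere_dense_in (D k)) /\
    Y `&` X `&` B n `<=` \bigcup_k D k by have [D D1 D2] := mB n; exists D.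
exists (fun k => if unpickle k is Some p then D p.1 p.2 else set0) => [k|a].
  case: unpickle => [[i j]|] /=; first exact: (DE i).1.
  by split; [exact: type_definable0|exact: nowhere_dense_set0].
move=> [YXa [n _ Ba]]; have [k _ Da] := (DE n).2 a (conj YXa Ba).
by exists (pickle (n, k)) => //; rewrite pickleK.
Qed.

Lemma meagerU B B' : meager_in B -> meager_in B' -> meager_in (B `|` B').
Proof.
move=> mB mB'; rewrite -bigcup2E; apply: meager_bigcup => -[|[|n]] //=.
by apply: meager_nowhere_dense; [exact: type_definable0|exact: nowhere_dense_set0].
Qed.

Lemma meager_translate B c : Gam c -> meager_in B ->
  meager_in [set x | B (c ** x)].
Proof.
move=> Gc [D DE BD]; have [GamH' _ _ GamV] := Gam_sub; have [_ _ YM _] := Y_sub.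
have Gic := GamV _ Gc; have Hc := GamH Gc.
exists (fun n => [set x | H x /\ D n (c ** x)]) => [n|a].
  have [tD nD] := DE n; split.
    exact: (type_definable_translate K_inf S_sat I_small H_def A_small Gam_sub).
  move=> O OO [x [Ox Xx]].
  have OO' : type_open S A (~` [set y | H y /\ (~` O) (inv c ** y)]).
    apply: type_openC.
    exact: (type_definable_translate K_inf S_sat I_small H_def A_small Gam_sub).
  have [|y [[Oy Xy] nDy]] := nD _ OO'.
    exists (c ** x); split; last exact: X_inv.
    by move=> [_]; rewrite group_mulKl //; exact: X_H.
  exists (inv c ** y); split; last first.
    by move=> [_]; rewrite group_mulVKl //; exact: X_H.
  split; last exact: X_inv.
  by apply: contrapT => nO; apply: Oy; split=> //; exact: X_H.
move=> [[Ya Xa] /= Ba]; have [|n _ Dn] := BD (c ** a).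
  split=> //; split; last exact: X_inv.
  by apply: YM => //; exact/GY/Gam_G.
by exists n => //; split=> //; exact: X_H.
Qed.

(** The limit of a run must also lie in [X] here. There are countably many formulas over [A], so
    those defining [X] are imposed one per round, next to avoiding [D n]. *)
Lemma not_meagerT : ~ meager_in setT.
Proof.
move=> [D DE DT]; have [X0 [pi XE] sX] := X_spread.
have [code code_inj] := formulas_countable.
have /choice[psi psiE] n : exists phi : formula L (I + A),
    X `<=` realizations S phi /\
    forall phi', pi phi' -> code phi' = n -> phi = phi'.
  have [[phi [piphi <-]]|nn] := pselect (exists phi, pi phi /\ code phi = n).
    exists phi; split=> [x|phi' _ /code_inj//].
    by rewrite XE; exact.
  exists (Not Bot); split=> [x _ []|phi' p1 p2].
  by case: nn; exists phi'.
have [|O n OO OX|y Yy yQ] := winnable_Baire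
    (Q := fun n => ~` D n `&` realizations S (psi n)) Y_win X_spread.
- move=> n; apply: type_openI; last exact: type_open_realizations.
  by apply: type_openC; have [] := DE n.
- have [_ /(_ O OO OX)[x [[Ox Xx] nDx]]] := DE n.
  by exists x; do !split=> //; exact: (psiE n).1.
have Xy : X y.
  rewrite XE => phi piphi; have [_] := yQ (code phi).
  by rewrite ((psiE (code phi)).2 phi piphi erefl).
have [n _ Dn] := DT y (conj (conj Yy Xy) Logic.I).
by have [] := yQ n.
Qed.

(** The Baire property, relative to [X] and tested on [Y]. *)
Definition almost_open (B : set (I -> C)) : Prop :=
  exists2 O, type_open S A O & meager_in [set a | ~ (B a <-> O a)].

Lemma almost_open_eq B B' : (forall a, Y a -> B a <-> B' a) ->
  almost_open B -> almost_open B'.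
Proof.
move=> BB [U OU mU]; exists U => //; apply: meager_sub mU => a [[Ya _] nB'] h.
by apply: nB'; rewrite -BB.
Qed.

Lemma almost_open_open O : type_open S A O -> almost_open O.
Proof.
move=> OO; exists O => //; apply: (meager_sub (B' := set0)).
  by move=> a [_ []].
by apply: meager_nowhere_dense; [exact: type_definable0|exact: nowhere_dense_set0].
Qed.

(** The complement agrees with the exterior [O'] of [O] in [X], up to the boundary, which is closed
    and nowhere dense. *)
Lemma almost_openC B : almost_open B -> almost_open (~` B).
Proof.
case=> O OO mO.
pose O' : set (I -> C) :=
  \bigcup_(phi in [set phi | realizations S phi `&` O `&` X = set0])
  @realizations _ _ S A I phi.
have OO' : type_open S A O'.
  by apply: type_open_bigcup => phi _; exact: type_open_realizations.
exists O' => //.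
have nD : meager_in (~` (O `|` O')).
  apply: meager_nowhere_dense.
    rewrite setCU; apply: type_definableI; exact.
  move=> N ON [x [Nx Xx]].
  have [[y [[Ny Oy] Xy]]|n] := pselect (N `&` O `&` X !=set0).
    by exists y; split=> //; apply; left.
  exists x; split=> //; apply; right.
  have [phi phix phiN] := type_open_nbhs ON Nx.
  exists phi => //; apply/seteqP; split=> // y [[phiy Oy] Xy].
  by apply: n; exists y; split=> //; split=> //; exact: phiN.
apply: meager_sub (meagerU mO nD) => a [[Ya Xa] nB].
have [Ba|nBa] := pselect (B a <-> O a); last by left.
right=> h; apply: nB; split=> [nBa|O'a /Ba Oa].
  by case: h => // Oa; case: nBa; apply/Ba.
have [phi phi0 phia] := O'a.
suff : (realizations S phi `&` O `&` X) a by rewrite phi0.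
by [].
Qed.

Lemma almost_open_bigcup (B : nat -> set (I -> C)) :
  (forall n, almost_open (B n)) -> almost_open (\bigcup_n B n).
Proof.
move=> mB; have /choice[U UE] n : exists U, type_open S A U /\
    meager_in [set a | ~ (B n a <-> U a)] by have [U U1 U2] := mB n; exists U.
exists (\bigcup_n U n).
  by apply: type_open_bigcup => n _; exact: (UE n).1.
apply: meager_sub (meager_bigcup (fun n => (UE n).2)) => a [_ nB].
apply: contrapT => nn; apply: nB.
have BO n : B n a <-> U n a.
  by apply: contrapT => h; apply: nn; exists n.
by split=> -[n _ /BO]; exists n.
Qed.

(** The sets of types whose preimage has the Baire property form a sigma-algebra containing the open
    sets. *)
Lemma almost_open_borel (M : set C) (B : set (types_in S M Y)) : M `<=` A ->
  <<s [set U | open U] >> B ->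
  almost_open [set a | exists2 q, B q & set_val q = tp S M a].
Proof.
move=> MA; apply: (@smallest_sub _ (sigma_algebra setT) _
    [set B : set (types_in S M Y) |
     almost_open [set a | exists2 q, B q & set_val q = tp S M a]]).
  split.
  - apply: almost_open_eq (almost_open_open (type_open0 _ _ _)) => a _.
    by split=> // -[].
  - move=> B1 /almost_openC; apply: almost_open_eq => a Ya; split.
      move=> nB; exists (elt (imageP (tp S M) Ya)) => //; split=> // h.
      by apply: nB; eexists; first exact: h.
    move=> [q [_ nq] eq] [q' Bq' eq']; apply: nq.
    by rewrite (_ : q = q') //; apply: set_val_inj; rewrite eq.
  - move=> B1 /almost_open_bigcup; apply: almost_open_eq => a Ya; split.
      by move=> [n _ [q Bq eq]]; exists q => //; exists n.
    by move=> [q [n _ Bq] eq]; exists n => //; exists q.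
move=> U /open_types_inE[U' OU' UE].
apply: almost_open_eq (almost_open_open (type_open_subset MA (type_open_tp OU'))).
move=> a Ya; rewrite -UE; split=> /= [Ua|[q Uq <-//]].
by exists (elt (imageP (tp S M) Ya)).
Qed.

(* Generic ergodicity: the translates of an open set meeting [X] by the
   countable group [Gam] cover [X]. *)
Lemma zero_one B : (forall c a, Gam c -> Y a -> X a -> B (c ** a) -> B a) ->
  almost_open B -> meager_in B \/ meager_in (~` B).
Proof.
move=> invB; case=> O OO mO.
have [OX|nOX] := pselect (O `&` X !=set0); last first.
  left; apply: meager_sub mO => a [[Ya Xa] Ba] [/(_ Ba) Oa _].
  by apply: nOX; exists a.
right.
have [code code_inj] := countable_embeds Gam_countable.
pose T k : set (I -> C) :=
  [set a | exists2 c : Gam, code c = k &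
     ~ (B (set_val c ** a) <-> O (set_val c ** a))].
apply: (meager_sub (B' := \bigcup_k T k)) => [a [[Ya Xa] nBa]|].
  have [c Gc Oc] := X_tr OO OX Xa.
  exists (code (elt Gc)) => //; exists (elt Gc) => // -[_ /(_ Oc) Bc].
  by apply/nBa/(invB c).
apply: meager_bigcup => k.
have [[c ck]|nk] := pselect (exists c, code c = k).
  apply: meager_sub (meager_translate (set_val_in c) mO) => a [_ [d dk]].
  by rewrite -ck in dk; rewrite (code_inj _ _ dk).
apply: (meager_sub (B' := set0)); first by move=> a [_ [c ck]]; case: nk; exists c.
by apply: meager_nowhere_dense; [exact: type_definable0|exact: nowhere_dense_set0].
Qed.

(* If such a class contained an open part of [X], it would contain a point of [G],
   hence be inside some [W m]. *)
Lemma meager_class M b : M `<=` A -> H b ->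
  meager_in [set a | exists a' b', [/\ same_type S M a a', same_type S M b b',
     H b' & exists2 w, G w & a' = w ** b']].
Proof.
move=> MA Hb.
have sM : small K M by apply: small_card_le A_small; exact: subset_card_le.
pose T : set (I -> C) := H `&` [set b' | same_type S M b b'].
have tT : type_definable S M T.
  apply: type_definableI; first exact: (type_definable_H H_def).
  rewrite (_ : mkset _ = \bigcap_(phi in [set phi | holds S phi b])
      @realizations _ _ S M I phi).
    by apply: type_definable_bigcap => phi _; exact: type_definable_realizations.
  by apply/seteqP; split.
have WH n : W n `<=` H.
  by move=> x Wx; apply: GH; rewrite (filtrationE GW); exists n.
have tD n : type_definable S M (prod_set g (W n) T).
  apply: (type_definable_prod K_inf S_sat) => //; first by move=> x [].
  exact: type_definable_subset (sub0set M) (filtration_td GW n).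
apply: (meager_sub (B' := \bigcup_n prod_set g (W n) T)).
  move=> a [_ [a' [b' [aa' bb' Hb' [w]]]]].
  rewrite (filtrationE GW) => -[n _ Ww] a'E; exists n => //.
  apply: type_definable_same_type (tD n) (same_type_sym aa') _.
  by exists w, b'.
apply: meager_bigcup => n; apply: meager_nowhere_dense.
  exact: type_definable_subset MA (tD n).
move=> O OO OX; have [_ _ sX] := X_spread.
have [x [Ox Xx Gx _]] := sX O 0 OO OX.
have [nTx|/contrapT[w [b1 [Ww [Hb1 bb1] xE]]]] := pselect (~ prod_set g (W n) T x).
  by exists x.
have [k _ Wkx] : (\bigcup_n W n) x by rewrite -(filtrationE GW).
have Wb1 : W (n + k) b1.
  rewrite -(group_mulKl g (WH _ _ Ww) Hb1) -xE.
  by apply: (filtrationM GW) => //; exact: (filtrationV GW).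
have [y [Oy Xy _ nWy]] := sX O (n + (n + k)) OO OX.
exists y; split=> // -[v [b2 [Wv [Hb2 bb2] yE]]]; apply: nWy.
rewrite yE; apply: (filtrationM GW) => //.
have tW : type_definable S M (W (n + k)).
  exact: type_definable_subset (sub0set M) (filtration_td GW _).
have Wb := type_definable_same_type tW (same_type_sym bb1) Wb1.
exact: type_definable_same_type tW bb2 Wb.
Qed.

Lemma not_borel_reducible M : M `<=` A -> Y `<=` H ->
  ~ exists2 f : types_in S M Y -> cantor_space, borel_map f &
      forall p q : types_in S M Y,
        type_equiv (coset_equiv g G Y) (set_val p) (set_val q) <-> f p = f q.
Proof.
move=> MA YH [f f_borel fE].
pose pt a (Ya : Y a) : types_in S M Y := elt (imageP (tp S M) Ya).
pose B i := [set a | exists2 q : types_in S M Y, f q i & set_val q = tp S M a].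
have BE a (Ya : Y a) i : B i a <-> f (pt a Ya) i.
  split=> [[q fq eq]|fp]; last by exists (pt a Ya).
  by rewrite (_ : pt a Ya = q) //; apply: set_val_inj; rewrite eq.
have [_ G1 _ GV] := filtration_subgroup GW; have [_ _ YM _] := Y_sub.
have [_ _ GM _] := filtration_subgroup GW.
have f_inv c a (Gc : Gam c) (Ya : Y a) (Yca : Y (c ** a)) :
    f (pt _ Yca) = f (pt _ Ya).
  apply/fE; exists (c ** a), a; split=> //; split=> //.
  have Hc := GamH Gc; have Ha := YH _ Ya; have GGc := Gam_G Gc.
  apply/seteqP; split=> _ [x Gx <-].
    exists (x ** c); first exact: GM.
    by rewrite mul_assoc //; exact: GH.
  exists (x ** inv c); first by apply: GM => //; exact: GV.
  rewrite -mul_assoc //; [|exact: GH|exact: inv_in|exact: mul_in].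
  by rewrite group_mulKl.
(* The zero-one law applies to one coordinate at a time; the countably many generic values make up
   the generic value [e] of the map. *)
have B01 i : exists e : bool, meager_in [set a | ~ (B i a <-> e)].
  have aB : almost_open (B i).
    apply: (almost_open_borel (B := f @^-1` [set c : cantor_space | c i])) => //.
    by apply: f_borel; apply: sub_sigma_algebra; exact: cantor_coordinate_open.
  have [|mB|mB] := zero_one _ aB.
  - move=> c a Gc Ya Xa; have Yca : Y (c ** a) by apply: YM => //; exact/GY/Gam_G.
    by move=> /(BE _ Yca); rewrite f_inv // => h; apply/(BE a Ya).
  - exists false; apply: meager_sub mB => a [_ nB].
    by apply: contrapT => nBa; apply: nB; split.
  - by exists true; apply: meager_sub mB => a [_ nB] Ba; apply: nB; split.
have /choice[e eE] := B01.
pose D := \bigcup_i [set a | ~ (B i a <-> e i)].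
have mD : meager_in D by exact: meager_bigcup.
have [b [[Yb Xb] nDb]] : exists b, (Y `&` X) b /\ ~ D b.
  apply: contrapT => /forallNP nb; apply: not_meagerT.
  apply: meager_sub mD => a [YXa _]; apply: contrapT => nDa.
  by apply: (nb a).
have fb_eq a (Ya : Y a) : ~ D a -> f (pt a Ya) = e :> (nat -> bool).
  move=> nDa; apply/funext => i; apply/idP/idP.
    move=> /(BE a Ya) Ba; apply: contrapT => ne.
    by apply: nDa; exists i => // -[/(_ Ba)].
  move=> ei; apply/(BE a Ya); apply: contrapT => nBa.
  by apply: nDa; exists i => // -[_ /(_ ei)].
apply: not_meagerT.
apply: meager_sub (meagerU mD (meager_class MA (YH _ Yb))) => a [[Ya Xa] _].
have [Da|nDa] := pselect (D a); first by left.
right.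
have /fE[a' [b' [ea eb [Ya' Yb' E]]]] : f (pt a Ya) = f (pt b Yb).
  by rewrite (fb_eq a Ya nDa) (fb_eq b Yb nDb).
exists a', b'; split.
- exact/same_type_tp/esym.
- exact/same_type_tp/esym.
- exact: YH.
have : Defs.coset g G a' a'.
  by exists one => //; apply: one_mul; exact: YH.
by rewrite E => -[w Gw <-]; exists w.
Qed.

End Category.
End Smooth.

(** The model [M] of the reduction may miss the coordinates of [Gam]. The category argument is
    therefore run over a countable model [N] containing both, while the map remains defined on types
    over [M]. *)
Lemma not_smooth (K : Type) (L : language) (C : Type) (S : structure L C)
    (I : Type) (H G H0 : set (I -> C)) (g : group_on H)
    (W : nat -> set (I -> C)) :
  small K [set: nat] -> saturated K S -> small K [set: I] ->
  type_definable_group S g -> filtration S g G W -> (forall n, ~ G `<=` W n) ->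
  small K (cosets g G H) -> G `<=` H0 -> subgroup g H0 ->
  [\/ pseudo_Gdelta K S H0, pseudo_closed K S H0 | pseudo_strong_Choquet K S H0] ->
  countable_language L -> countable [set: I] ->
  ~ smooth S H0 (coset_equiv g G H0).
Proof.
move=> K_inf S_sat I_small H_def GW unb idx GH0 H0_sub pH0 [cF cR] cI.
move=> [M [cM elM fE]].
have [Gam [sGam GamG cGam ex]] :=
  invariant_spread K_inf S_sat I_small H_def GW unb idx.
have nat_inf : infinite_type nat by exists id.
have eF := (card_leTE _ _).1 cF; have eR := (card_leTE _ _).1 cR.
have eI := (card_leTE _ _).1 cI.
have eA : embeds (M `|` coordinates Gam) nat.
  apply: embeds_trans (embeds_setU _ _) _.
  apply: embeds_sum_infinite => //; first exact: countable_embeds.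
  apply: embeds_trans (embeds_coordinates Gam) _.
  by apply: embeds_prod_infinite => //; exact: countable_embeds.
have [N [AN elN eN]] := downward_Lowenheim_Skolem S nat_inf eF eR eA.
have sN : small K N by apply/small_setT; exact: small_embeds eN K_inf.
have GamN : coordinates Gam `<=` N by move=> c Gc; apply: AN; right.
have MN : M `<=` N by move=> c Mc; apply: AN; left.
have [X [XH iX trX sX]] := ex N sN GamN.
have wH0 : winnable S N G H0.
  exact: (winnable_of_pseudo K_inf S_sat I_small GW (conj sN elN)).
have eform : embeds (formula L (I + N)) nat.
  by apply: embeds_formula => //; exact: embeds_sum_infinite.
have H0H : H0 `<=` H by have [] := H0_sub.
exact: (not_borel_reducible K_inf S_sat I_small H_def GW sN sGam GamG cGam GamN
  XH iX trX sX H0_sub GH0 wH0 eform MN H0H fE).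
Qed.

Theorem corollary3p37 (L : language) (T : theory L)
    (K C : Type) (S : structure L C) (alpha : Type)
    (H : set (alpha -> C)) (g : group_on H)
    (V : nat -> set (alpha -> C)) (G H0 : set (alpha -> C))
    (T_complete : complete_theory T)
    (C_monster : monster_model K T S)
    (alpha_small : small K [set: alpha])
    (H_def : type_definable_group S g)
    (V_def : forall n, type_definable S set0 (V n))
    (V_sub : forall n, V n `<=` H)
    (G_gen : G = generated g (\bigcup_n V n))
    (G_H0 : G `<=` H0)
    (H0_sub : subgroup g H0)
    (H0_top : [\/ pseudo_Gdelta K S H0, pseudo_closed K S H0
                | pseudo_strong_Choquet K S H0]) :
  (small K (cosets g G H) ->
    [/\ [\/ pseudo_Gdelta K S G, pseudo_closed K S G
          | pseudo_strong_Choquet K S G] ->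
          pseudo_closed K S G /\ generated_in_finitely_many_steps g V G,
        ~ pseudo_closed K S G -> [set: nat -> bool] #<= cosets g G H0,
        countable_language L -> countable [set: alpha] ->
          pseudo_closed K S G \/ ~ smooth S H0 (coset_equiv g G H0) &
        small_theory S -> finite_set [set: alpha] -> pseudo_closed K S G]) /\
  (pseudo_closed K S G -> generated_in_finitely_many_steps g V G).
Proof.
have [_ K_inf K_func K_rel S_sat _] := C_monster.
have GW : filtration S g G (word_ball g V).
  rewrite G_gen.
  exact: (word_ball_filtration K_inf S_sat alpha_small H_def V_sub V_def).
have closed n : G `<=` word_ball g V n -> pseudo_closed K S G.
  exact: (type_definable_bound K_inf GW).
have gen n : G `<=` word_ball g V n -> generated_in_finitely_many_steps g V G.
  exact: (generated_of_word_ball V_sub).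
split; last first.
  move=> cG; have [n Gn] :=
    bounded_of_pseudo_closed K_inf S_sat alpha_small H_def GW cG.
  exact: gen Gn.
move=> idx; split.
- move=> pG; have [n Gn] := bounded_of_pseudo K_inf S_sat K_func K_rel alpha_small
    H_def GW idx pG.
  by split; [exact: closed Gn|exact: gen Gn].
- move=> ncG; have unb n : ~ G `<=` word_ball g V n by move=> /closed.
  have s0 : small K (@set0 C) by apply: small_countable => //; exact: countable0.
  have [M [X [sM _ XH sX]]] :=
    model_spread K_inf S_sat K_func K_rel alpha_small H_def GW unb idx s0.
  have H0H : H0 `<=` H by have [] := H0_sub.
  have wH0 : winnable S M G H0.
    exact: (winnable_of_pseudo K_inf S_sat alpha_small GW).
  exact: (continuum_cosets K_inf S_sat alpha_small H_def GW sM.1 sX H0H wH0).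
- move=> cL ca; have [cG|ncG] := pselect (pseudo_closed K S G); first by left.
  right; have unb n : ~ G `<=` word_ball g V n by move=> /closed.
  exact: (not_smooth K_inf S_sat alpha_small H_def GW unb idx G_H0 H0_sub H0_top).
- move=> sT fin_alpha.
  have [n Gn] := type_countable_bounded K_inf S_sat K_func K_rel alpha_small
    H_def GW idx sT fin_alpha.
  exact: closed Gn.
Qed.
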